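(* Let $C>0$, $\rho\in\,]0,1[$ and $\theta\in\mathbb R$ be fixed. For every $\delta>0$ there is a constant $C(\delta)>0$ (which, $C,\rho,\theta$ being fixed, depends only on $\delta$) such that the following holds. Let $N$ be a positive integer and let $(q_k)_{1\le k\le N}$ be an increasing sequence of positive integers such that $$q_k/q_m\le C\,\rho^{\,m-k},\quad 1\le k<m\le N.$$ Let $(f_k)_{1\le k\le N}$ be real centered functions of bounded variation on $X$ such that, for constants $u_k$, $$\|f_k\|_\infty\le u_k,\qquad V(f_k)\le C\,u_k\,q_k,\qquad 1\le k\le N.$$ Assume moreover the decorrelation properties $$\Big|\int_X\psi f_k\,d\mu\Big|\le C\,V(\psi)\,u_k\,\frac{k^\theta}{q_k},\quad 1\le k\le N,\ \text{for all }\psi\text{ of bounded variation},$$ $$\Big|\int_X\psi f_kf_m\,d\mu\Big|\le C\,V(\psi)\,u_ku_m\,\frac{m^\theta}{q_k},\quad 1\le k\le m\le N,\ \text{for all centered }\psi\text{ of bounded variation},$$ $$\Big|\int_X\psi f_kf_mf_t\,d\mu\Big|\le C\,V(\psi)\,u_ku_mu_t\,\frac{t^\theta}{q_k},\quad 1\le k\le m\le t\le N,\ \text{for all centered }\psi\text{ of bounded variation}.$$ Put $w_N:=\max_{1\le j\le N}u_j$ and $S_N:=f_1+\dots+f_N$, and assume $\|S_N\|_2>0$. If $$\frac{w_N}{\|S_N\|_2}\le N^{p-\frac12}\quad\text{for some }p\in[0,\tfrac18[,$$ then $$d\Big(\frac{S_N}{\|S_N\|_2},Y_1\Big)\le C(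\delta)\,N^{-\frac{1-8p}{12}+\delta}.$$
   Context: $X=\mathbb T^1=\mathbb R/\mathbb Z\simeq[0,1[$ with Lebesgue measure $\mu$; $\|\cdot\|_2$ is the $L^2(\mu)$ norm. Functions on $X$ are viewed as 1-periodic functions and $V(f)$ is the total variation of the restriction of $f$ to $[0,1]$. ''Centered'' means $\int_X f\,d\mu=0$. $S_N/\|S_N\|_2$ is viewed as a random variable on $(X,\mu)$. $Y_1$ has the standard normal law $\mathcal N(0,1)$, and $d(X,Y)=\sup_{x\in\mathbb R}|\mathbb P(X\le x)-\mathbb P(Y\le x)|$ is the Kolmogorov distance. *)

(* Defs.v *)
From HB Require Import structures.
From mathcomp Require Import all_boot all_order all_algebra.
From mathcomp Require Import all_classical all_reals all_analysis.

Set Implicit Arguments.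
Unset Strict Implicit.
Unset Printing Implicit Defensive.

Import Order.TTheory GRing.Theory Num.Theory.
Import numFieldNormedType.Exports.

Local Open Scope classical_set_scope.
Local Open Scope ring_scope.

(* The circle R/Z is identified with [0,1[.  A function on the circle is a
   1-periodic function R -> R, and the measure of the circle is carried by R. *)
Section circle.
Context {R : realType}.

Definition circle_measure : set (measurableTypeR R) -> \bar R :=
  mrestr lebesgue_measure (measurable_itv `[(0 : R), 1[).

HB.instance Definition _ := Measure.on circle_measure.

Let circle_measure_setT : circle_measure setT = 1%E.
Proof.
by rewrite /circle_measure/= /mrestr setTI lebesgue_measure_itv/= lte_fin ltr01 sube0.
Qed.

HB.instance Definition _ :=
  @Measure_isProbability.Build _ _ R circle_measure circle_measure_setT.

Definition circle_int (f : R -> R) : R := \int[circle_measure]_x f x.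

Definition centered (f : R -> R) : Prop := circle_int f = 0.

Definition circle_bv (f : R -> R) : Prop :=
  periodic f 1 /\ bounded_variation 0 1 f.

(* The total variation is finite under [circle_bv], so [fine] loses nothing. *)
Definition circle_var (f : R -> R) : R := fine (total_variation 0 1 f).

(* [circle_bv] functions are bounded, so the extended-real norm is finite. *)
Definition L2norm (f : R -> R) : R :=
  fine (Lnorm circle_measure 2%:E (EFin \o f)).

(* Kept in [\bar R]; the exponent [+oo] gives the essential supremum norm. *)
Definition Linfnorm (f : R -> R) : \bar R :=
  Lnorm circle_measure +oo%E (EFin \o f).

Definition partial_sum (f : nat -> R -> R) (N : nat) (x : R) : R :=
  \sum_(1 <= k < N.+1) f k x.

(* The base value [u 1] makes this the genuine maximum over
   1 <= j <= N as soon as N > 0. *)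
Definition max_upto (u : nat -> R) (N : nat) : R :=
  \big[Num.max/u 1%N]_(1 <= j < N.+1) u j.

End circle.

(* The law is compared on measurable sets only: the values of a measure on
   other sets carry no meaning. *)
Definition standard_normal {R : realType} d (T : measurableType d)
    (P : probability T R) (Y : {RV P >-> R}) : Prop :=
  forall A : set R, measurable A -> distribution P Y A = normal_prob 0 1 A.

Definition kolmogorov_dist {R : realType} d (T : measurableType d)
    (P : probability T R) d' (T' : measurableType d') (P' : probability T' R)
    (X : T -> R) (Y : T' -> R) : R :=
  sup [set `|fine (P [set t | X t <= x]) - fine (P' [set t | Y t <= x])|
      | x in [set: R]].

(* Main.v *)
Require Import Defs.
From HB Require Import structures.
From mathcomp Require Import all_boot all_order all_algebra.
From mathcomp Require Import all_classical all_reals all_analysis.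
From mathcomp Require Import measurable_realfun ess_sup_inf zify ring lra.

Set Implicit Arguments.
Unset Strict Implicit.
Unset Printing Implicit Defensive.

Import Order.TTheory GRing.Theory Num.Theory.
Import numFieldNormedType.Exports.

Local Open Scope classical_set_scope.
Local Open Scope ring_scope.

(** Lindeberg's method, run along the single summands. With
    [X_k = f_k / ||S_N||_2], [T_k = X_1 + ... + X_k] and [V_k = ||T_k||_2 ^ 2],
    the means of [Phi ((a - T_k) / s_k)], where [s_k ^ 2 = 2 e ^ 2 + 1 - V_k]
    and [Phi] is the normal distribution function, hardly depend on [k]: in the
    expansion of one step, the first derivative is frozen [M] indices earlier
    and the second one [2 M] indices earlier, the decorrelation hypotheses then
    replace products by products of means, and the change of scale from
    [s_(k-1)] to [s_k] compensates the second order term. The case [k = 0] is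
    [Phi (a / sqrt (1 + 2 e ^ 2))] and the case [k = N] is a smoothing of the
    distribution function of [S_N / ||S_N||_2] at scale [sqrt 2 * e]. With
    [r = (1 - 8 p) / 12], the choice [M ~ N ^ (1 / 48)],
    [e ~ N ^ (- 3 r / 2)] and a smoothing window of [N ^ (r / 2)] scales gives
    the rate [N ^ (- r)]. *)

(** A gap of [M] indices helps because a Lipschitz function of [T_j] has variation at most of order
    [N * q_j], while the decorrelation hypotheses divide by [q_k]. The quotient is at most
    [C * rho ^ M] when [j <= k - M], and this beats every power of [N] once [M] is a power of [N].
    The variances [V_k] may exceed [V_N = 1], and the term [2 * e ^ 2] keeps [s_k >= e] all the
    same. With [|X_k| <= b = N ^ (p - 1 / 2)], a step costs [M ^ 2 * b ^ 3 / e ^ 3]. For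
    [M ~ N ^ eta] the [N] steps cost [N ^ (2 * eta - 1 / 8)], whatever [p] is, and [1 / 48] is the
    largest [eta] that makes this at most [N ^ (- 1 / 12)], the rate at [p = 0]. The sup bounds on
    the [f_k] are only essential ones, so the [X_k] are clipped. *)

(** * Mean value and Taylor inequalities on the line *)

Section real_calculus.
Context {R : realType}.
Implicit Types (f g : R -> R) (x y K : R).

Lemma is_derive_continuous f (df : R -> R) :
  (forall x : R, is_derive x 1 f (df x)) -> continuous f.
Proof.
by move=> fE x; apply/differentiable_continuous/derivable1_diffP; case: (fE x).
Qed.

Lemma MVT_between f (df : R -> R) x y :
  (forall z : R, is_derive z 1 f (df z)) ->
  exists c, [/\ f y - f x = df c * (y - x), `|c - x| <= `|y - x|
             & Num.min x y <= c <= Num.max x y].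
Proof.
move=> fE.
have cf a b : {within `[a, b], continuous f}.
  by apply: continuous_subspaceT; exact: is_derive_continuous fE.
have [xy|yx] := leP x y.
- have [c] := MVT_segment xy (fun z _ => fE z) (cf x y).
  rewrite in_itv/= => /andP[xc cy] E; exists c; split=> //.
  + by rewrite !ger0_norm ?subr_ge0// lerB.
  + by rewrite xc.
- have [c] := MVT_segment (ltW yx) (fun z _ => fE z) (cf y x).
  rewrite in_itv/= => /andP[yc cx] E; exists c; split.
  + by rewrite -opprB E -mulrN opprB.
  + by rewrite !ler0_norm ?subr_le0 ?(ltW yx)//; lra.
  + by rewrite yc.
Qed.

Lemma lipschitz_of_deriv f (df : R -> R) K :
  (forall z : R, is_derive z 1 f (df z)) -> (forall z, `|df z| <= K) ->
  forall x y, `|f y - f x| <= K * `|y - x|.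
Proof.
move=> fE dfK x y; have [c [-> _ _]] := MVT_between x y fE.
by rewrite normrM ler_wpM2r.
Qed.

(** The mean value theorem gives [df c * h], and [df] is [K]-Lipschitz. The factorials are given up,
    since only orders of magnitude matter. *)
Lemma taylor2 f (df d2f : R -> R) K :
  (forall z : R, is_derive z 1 f (df z)) -> (forall z : R,
    is_derive z 1 df (d2f z)) ->
  (forall z, `|d2f z| <= K) ->
  forall x h, `|f (x + h) - f x - df x * h| <= K * h ^+ 2.
Proof.
move=> fE dfE d2K x h; have [c [E cx _]] := MVT_between x (x + h) fE.
move: E cx; rewrite [x + h - x]addrC addKr => -> cx.
rewrite -mulrBl normrM -real_normK ?num_real// expr2 mulrA ler_wpM2r//.
apply: le_trans (lipschitz_of_deriv dfE d2K x c) _.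
by rewrite ler_wpM2l// (le_trans _ (d2K 0)).
Qed.

Lemma taylor3 f (df d2f d3f : R -> R) K :
  (forall z : R, is_derive z 1 f (df z)) -> (forall z : R,
    is_derive z 1 df (d2f z)) ->
  (forall z : R, is_derive z 1 d2f (d3f z)) -> (forall z, `|d3f z| <= K) ->
  forall x h,
    `|f (x + h) - f x - df x * h - d2f x * (h ^+ 2 / 2)| <= K * `|h| ^+ 3.
Proof.
move=> fE dfE d2E d3K x h.
have K0 : 0 <= K by rewrite (le_trans _ (d3K 0)).
(* The derivative of this remainder is the first-order Taylor remainder of [df]. *)
pose r (z : R) := f z - df x * z - d2f x * ((z - x) ^+ 2 / 2).
have rE (z : R) : is_derive z 1 r (df z - df x - d2f x * (z - x)).
  have ? := fE z; rewrite /r; apply: is_derive_eq.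
  by rewrite /GRing.scale/=; field.
have [c [E cx _]] := MVT_between x (x + h) rE.
have -> : f (x + h) - f x - df x * h - d2f x * (h ^+ 2 / 2) = r (x + h) - r x.
  by rewrite /r; field.
rewrite E; move: cx; rewrite [x + h - x]addrC addKr => cx.
rewrite normrM exprSr mulrA ler_wpM2r//.
have := taylor2 dfE d2E d3K x (c - x).
rewrite [x + _]addrC subrK => /le_trans; apply; rewrite ler_wpM2l//.
by rewrite -real_normK ?num_real// lerXn2r ?nnegrE.
Qed.

Lemma nondecreasing_of_deriv f (df : R -> R) :
  (forall z : R, is_derive z 1 f (df z)) -> (forall z, 0 <= df z) ->
  {homo f : x y / x <= y}.
Proof.
move=> fE df0 x y xy; have [c [E _ _]] := MVT_between x y fE.
by rewrite -subr_ge0 E mulr_ge0// subr_ge0.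
Qed.

Lemma is_derive_affine (f df : R -> R) (a s x : R) :
  is_derive ((a - x) / s) 1 f (df ((a - x) / s)) ->
  is_derive x 1 (fun x => f ((a - x) / s)) (- df ((a - x) / s) / s).
Proof.
move=> fE.
have E : is_derive x 1 (fun x => (a - x) / s) (- s^-1).
  rewrite [X in is_derive _ _ X _](_ : _ = s^-1 *: (fun x => a - x)).
    apply: is_derive_eq; by rewrite /GRing.scale/=; ring.
  by apply/funext => z; rewrite mulrC.
have := is_derive1_comp (f := f) (g := fun x => (a - x) / s) fE.
move/(_ _ E); rewrite mulrN mulNr; exact.
Qed.

End real_calculus.

(** * The normal distribution function and its tails *)

Section gaussian_cdf.
Context {R : realType}.

Definition gcdf (x : R) : R := fine (normal_prob 0 1 `]-oo, x]%classic).
Definition gpdf (x : R) : R := normal_pdf 0 1 x.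

Lemma gpdfE x : gpdf x = normal_peak 1 * expR (- (x ^+ 2) / 2).
Proof.
by rewrite /gpdf normal_pdfE ?oner_neq0// /normal_fun subr0 expr1n.
Qed.

Lemma is_derive_gcdf (x : R) : is_derive x 1 gcdf (gpdf x).
Proof.
have int y : lebesgue_measure.-integrable [set` Interval -oo%O (BRight y)]
    (EFin \o (normal_pdf 0 1 : R -> R)).
  by apply: integrableS (integrable_normal_pdf 0 1).
have x1 : x < x + 1 by rewrite ltrDl.
have cx : {for x, continuous (normal_pdf 0 1 : R -> R)}.
  by apply: continuous_normal_pdf; exact: oner_neq0.
have [dF F'] := continuous_FTC1 x1 (int _) (ltNyr _) cx.
have -> : gcdf = fun x => (\int[lebesgue_measure]_(t in `]-oo,
  x]) normal_pdf 0 1 t).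
  by apply/funext => y.
by rewrite /gpdf -F' derive1E; exact: derivableP.
Qed.

Lemma is_derive_gpdf (x : R) : is_derive x 1 gpdf (- (x * gpdf x)).
Proof.
have -> : gpdf = fun x => normal_peak 1 * expR (- (x ^+ 2) / 2).
  by apply/funext => y; rewrite gpdfE.
apply: is_derive_eq.
by rewrite /GRing.scale/=; field.
Qed.

Definition gpdf2 (x : R) : R := - (x * gpdf x).
Definition gpdf3 (x : R) : R := (x ^+ 2 - 1) * gpdf x.

Lemma is_derive_gpdf2 (x : R) : is_derive x 1 gpdf2 (gpdf3 x).
Proof.
have ? := is_derive_gpdf x; rewrite /gpdf2; apply: is_derive_eq.
by rewrite /gpdf3 /GRing.scale/=; ring.
Qed.

Lemma gpdf_ge0 x : 0 <= gpdf x. Proof. exact: normal_pdf_ge0. Qed.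

Lemma normal_peak1_le1 : normal_peak (1 : R) <= 1.
Proof.
rewrite /normal_peak expr1n mul1r invf_le1; last by rewrite sqrtr_gt0
  mulrn_wgt0// pi_gt0.
rewrite -[leLHS]sqrtr1 ler_wsqrtr// mulr2n.
by rewrite (le_trans _ (_ : 2 <= _))// ?(le_trans (pi_ge2 R))//
  ?lerDl ?pi_ge0// ler1n.
Qed.

(** This is the square of [exp (- y) * (1 + y) <= 1] at [y = x ^ 2 / 4]. A weight of degree four
    gives all the moment bounds at once. *)
Lemma gpdf_decay x : gpdf x * (1 + x ^+ 2 / 4) ^+ 2 <= 1.
Proof.
have p1 := normal_peak1_le1.
have -> : gpdf x * (1 + x ^+ 2 / 4) ^+ 2 =
    normal_peak 1 * (expR (- (x ^+ 2 / 4)) * (1 + x ^+ 2 / 4)) ^+ 2.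
  rewrite gpdfE (_ : - x ^+ 2 / 2 = - (x ^+ 2 / 4) + - (x ^+ 2 / 4));
    last by field.
  by rewrite expRD; ring.
rewrite mulr_ile1 ?exprn_ge0 ?mulr_ge0 ?expR_ge0 ?normal_peak_ge0//.
  by rewrite addr_ge0// mulr_ge0// sqr_ge0.
rewrite exprn_ile1 ?mulr_ge0 ?expR_ge0//.
  by rewrite addr_ge0// mulr_ge0// sqr_ge0.
by rewrite expRN -ler_pdivlMl ?invr_gt0 ?expR_gt0// invrK mulr1 expR_ge1Dx.
Qed.

Lemma gpdf_moment x i : (i <= 4)%N -> `|x| ^+ i * gpdf x <= 16.
Proof.
move=> i4; have g0 := gpdf_ge0 x; have := gpdf_decay x.
rewrite -(real_normK (num_real x)); set y := `|x|;
  have y0 : 0 <= y by exact: normr_ge0.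
move=> H; apply: (@le_trans _ _ (16 * (gpdf x * (1 + y ^+ 2 / 4) ^+ 2))).
  2: by nra.
rewrite mulrCA mulrC ler_wpM2l//.
case: i i4 => [_|[_|[_|[_|[_|//]]]]]; rewrite ?expr0 ?expr1; nra.
Qed.

Lemma gpdf_bound x : `|gpdf x| <= 16.
Proof. by rewrite ger0_norm ?gpdf_ge0// -[leLHS]mul1r (@gpdf_moment x 0). Qed.

Lemma gpdf2_bound x : `|gpdf2 x| <= 16.
Proof. by rewrite normrN normrM (ger0_norm (gpdf_ge0 _)) (@gpdf_moment x 1).
  Qed.

Lemma gpdf3_bound x : `|gpdf3 x| <= 32.
Proof.
have := gpdf_ge0 x; have := @gpdf_moment x 2 isT; have := gpdf_bound x.
rewrite /gpdf3 real_normK ?num_real// !ler_norml => /andP[? ?] ? ?.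
by apply/andP; split; nra.
Qed.

Lemma gcdf_ndecr : {homo gcdf : x y / x <= y}.
Proof. exact: nondecreasing_of_deriv is_derive_gcdf gpdf_ge0. Qed.

Let idTR : measurableTypeR R -> R := idfun.

#[local] HB.instance Definition _ :=
  @isMeasurableFun.Build _ _ _ _ idTR (@measurable_id _ _ setT).

(** Under the normal law the identity has distribution function [gcdf], which gives the limits of
    [gcdf] at infinity. *)
Let gid : {RV (normal_prob 0 1 : probability (measurableTypeR R) R) >-> R} :=
  idTR.

Let gcdfE x : (gcdf x)%:E = cdf gid x.
Proof. by rewrite fineK// fin_num_measure. Qed.

Lemma gcdf_cvgy : gcdf x @[x --> +oo] --> (1 : R).
Proof. by apply: fine_cvg; exact: (cvg_cdfy1 gid). Qed.

Lemma gcdf_cvgNy : gcdf x @[x --> -oo] --> (0 : R).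
Proof. by apply: fine_cvg; exact: (cvg_cdfNy0 gid). Qed.

Lemma gcdf_ge0 x : 0 <= gcdf x. Proof. exact: fine_ge0. Qed.

Lemma gcdf_le1 x : gcdf x <= 1.
Proof. by rewrite -lee_fin gcdfE cdf_le1. Qed.


(** From [(x + 1) ^ 2 >= 0] one gets [- x ^ 2 / 2 <= 1 / 2 + x], and [exp (1 / 2) <= 2]. An
    exponential majorant is its own primitive, which makes the tails immediate. *)
Lemma gpdf_le_exp x : gpdf x <= 2 * expR x.
Proof.
have p1 := normal_peak1_le1.
rewrite gpdfE; apply: le_trans (_ : expR (- x ^+ 2 / 2) <= _).
  by rewrite ler_piMl// expR_ge0.
apply: le_trans (_ : expR (2^-1 + x) <= _).
  by rewrite ler_expR; have := sqr_ge0 (x + 1); nra.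
rewrite expRD ler_wpM2r ?expR_ge0//.
have e0 : 0 < expR (- 2^-1 : R) by exact: expR_gt0.
have : expR (2^-1 : R) * expR (- 2^-1) = 1 by rewrite -expRD subrr expR0.
have := expR_ge1Dx (- 2^-1 : R).
by nra.
Qed.

Lemma gpdfN x : gpdf (- x) = gpdf x.
Proof. by rewrite !gpdfE sqrrN. Qed.

Lemma gcdf_lower_tail x : gcdf x <= 2 * expR x.
Proof.
have hE (z : R) : is_derive z 1 (fun z => 2 * expR z - gcdf z)
    (2 * expR z - gpdf z).
  have ? := is_derive_gcdf z; apply: is_derive_eq.
  by rewrite /GRing.scale/=; ring.
have h0 z : 0 <= 2 * expR z - gpdf z by rewrite subr_ge0 gpdf_le_exp.
apply/ler_addgt0Pr => e e0; near (ninfty_nbhs R) => y.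
have ye : gcdf y < e by near: y; exact: (cvgr_lt 0 gcdf_cvgNy).
have yx : y <= x by near: y; apply: nbhs_ninfty_le; exact: num_real.
have := nondecreasing_of_deriv hE h0 yx.
by have := expR_gt0 y; lra.
Unshelve. all: by end_near. Qed.

Lemma gcdf_upper_tail x : 1 - gcdf x <= 2 * expR (- x).
Proof.
have hE (z : R) : is_derive z 1 (fun z => gcdf z + 2 * expR (- z))
    (- (2 * expR (- z) - gpdf z)).
  have ? := is_derive_gcdf z; apply: is_derive_eq.
  by rewrite /GRing.scale/=; ring.
have hE' (z : R) : is_derive z 1 (fun z => - (gcdf z + 2 * expR (- z)))
    (2 * expR (- z) - gpdf z).
  by have ? := hE z; apply: is_derive_eq; rewrite opprK.
have h0 z : 0 <= 2 * expR (- z) - gpdf z.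
  by rewrite subr_ge0 -(gpdfN z) gpdf_le_exp.
apply/ler_addgt0Pr => e e0; near (pinfty_nbhs R) => y.
have ye : 1 - e < gcdf y.
  by near: y; apply: (cvgr_gt 1 gcdf_cvgy); rewrite ltrBlDr ltrDl.
have xy : x <= y by near: y; apply: nbhs_pinfty_ge; exact: num_real.
have := nondecreasing_of_deriv hE' h0 xy.
by have := expR_gt0 (- y); lra.
Unshelve. all: by end_near. Qed.

Lemma expRN_le (x : R) : 0 < x -> expR (- x) <= 4 / x ^+ 2.
Proof.
move=> x0; rewrite ler_pdivlMr ?exprn_gt0//.
have -> : expR (- x) * x ^+ 2 = (expR (- (x / 2)) * x) ^+ 2.
  by rewrite {1}(_ : - x = - (x / 2) + - (x / 2)); [rewrite expRD; ring|field].
have : expR (- (x / 2)) * (x / 2) <= 1.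
  rewrite expRN -ler_pdivlMl ?invr_gt0 ?expR_gt0// invrK mulr1.
  by apply: le_trans (expR_ge1Dx _); rewrite lerDr.
have : 0 <= expR (- (x / 2)) * (x / 2) by rewrite mulr_ge0 ?expR_ge0//
  divr_ge0// ltW.
rewrite (_ : _ * x = 2 * (expR (- (x / 2)) * (x / 2))); last by field.
by move: (_ * (x / 2)) => t; nra.
Qed.

(** A quadratic tail is enough: at [L = N ^ (r / 2)] it has the order [N ^ (- r)]. *)
Lemma gcdf_tailN x : 0 < x -> gcdf (- x) <= 8 / x ^+ 2.
Proof.
move=> x0; apply: le_trans (gcdf_lower_tail _) _.
have := expRN_le x0; rewrite -[8]/(8%:R) (_ : 8%:R = 2 * 4 :> R); last by ring.
by rewrite -mulrA => ?; rewrite ler_wpM2l.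
Qed.

Lemma gcdf_tail x : 0 < x -> 1 - gcdf x <= 8 / x ^+ 2.
Proof.
move=> x0; apply: le_trans (gcdf_upper_tail _) _.
have := expRN_le x0; rewrite (_ : 8%:R = 2 * 4 :> R); last by ring.
by rewrite -mulrA => ?; rewrite ler_wpM2l.
Qed.

End gaussian_cdf.

(** * Smoothed indicators of half-lines and their expansions *)

Section gaussian_test_functions.
Context {R : realType}.
Implicit Types a s e x y z t v : R.

(** For [s > 0], the probability that [x] plus a centered normal variable of variance [s ^ 2] is at
    most [a]. The next three are its derivatives in [x]. *)
Definition gtest a s x := gcdf ((a - x) / s).
Definition gtest1 a s x := - gpdf ((a - x) / s) / s.
Definition gtest2 a s x := gpdf2 ((a - x) / s) / s ^+ 2.
Definition gtest3 a s x := - gpdf3 ((a - x) / s) / s ^+ 3.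

Lemma is_derive_gtest a s x : is_derive x 1 (gtest a s) (gtest1 a s x).
Proof. exact: is_derive_affine (is_derive_gcdf _). Qed.

Lemma is_derive_gtest1 a s x : is_derive x 1 (gtest1 a s) (gtest2 a s x).
Proof.
have ? := is_derive_affine (df := fun y => - (y * gpdf y)) (is_derive_gpdf ((a
  - x) / s)).
have -> : gtest1 a s = (- s^-1) *: (fun x => gpdf ((a - x) / s)).
  by apply/funext => y; rewrite -[RHS]/(- s^-1 * gpdf ((a - y) / s)) /gtest1;
    ring.
apply: is_derive_eq.
by rewrite /gtest2 /gpdf2 /GRing.scale/= expr2 invfM; ring.
Qed.

Lemma is_derive_gtest2 a s x : is_derive x 1 (gtest2 a s) (gtest3 a s x).
Proof.
have ? := is_derive_affine (df := gpdf3) (is_derive_gpdf2 ((a - x) / s)).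
have -> : gtest2 a s = (s ^- 2) *: (fun x => gpdf2 ((a - x) / s)).
  by apply/funext => y; rewrite /gtest2 /= /GRing.scale/= mulrC.
apply: is_derive_eq.
by rewrite /gtest3 /GRing.scale/= !exprS expr0 mulr1 !invfM; ring.
Qed.

Lemma ler_div_exp (A s e : R) (n : nat) :
  0 <= A -> 0 < e -> e <= s -> A / s ^+ n <= A / e ^+ n.
Proof.
move=> A0 e0 es; have s0 : 0 < s by exact: lt_le_trans es.
by rewrite ler_wpM2l// lef_pV2 ?posrE ?exprn_gt0//
  lerXn2r ?nnegrE ?(ltW e0) ?(ltW s0).
Qed.

Lemma gtest2_bound a s e x : 0 < e -> e <= s -> `|gtest2 a s x| <= 16 / e ^+ 2.
Proof.
move=> e0 es; have s0 : 0 < s by exact: lt_le_trans es.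
rewrite /gtest2 normrM normfV (ger0_norm (exprn_ge0 _ (ltW s0))).
apply: le_trans (ler_div_exp 2 _ e0 es) => //.
by rewrite ler_wpM2r ?invr_ge0 ?exprn_ge0 ?(ltW s0)// gpdf2_bound.
Qed.

Lemma gtest3_bound a s e x : 0 < e -> e <= s -> `|gtest3 a s x| <= 32 / e ^+ 3.
Proof.
move=> e0 es; have s0 : 0 < s by exact: lt_le_trans es.
rewrite /gtest3 normrM normrN normfV (ger0_norm (exprn_ge0 _ (ltW s0))).
apply: le_trans (ler_div_exp 3 _ e0 es) => //.
by rewrite ler_wpM2r ?invr_ge0 ?exprn_ge0 ?(ltW s0)// gpdf3_bound.
Qed.

Lemma gtest1_lip a s e x y : 0 < e -> e <= s ->
  `|gtest1 a s y - gtest1 a s x| <= 16 / e ^+ 2 * `|y - x|.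
Proof.
move=> e0 es; apply: lipschitz_of_deriv (is_derive_gtest1 a s) _ x y.
by move=> z; exact: gtest2_bound.
Qed.

Lemma gtest2_lip a s e x y : 0 < e -> e <= s ->
  `|gtest2 a s y - gtest2 a s x| <= 32 / e ^+ 3 * `|y - x|.
Proof.
move=> e0 es; apply: lipschitz_of_deriv (is_derive_gtest2 a s) _ x y.
by move=> z; exact: gtest3_bound.
Qed.

(* The increment is expanded with its first derivative frozen at [r + w] and
   its second derivative frozen at [r]. *)
Lemma gtest_increment a s e r w D x m b :
  0 < e -> e <= s -> `|w| <= m -> `|D| <= m -> `|x| <= b -> b <= m ->
  `|gtest a s (r + w + D + x) - gtest a s (r + w + D) - gtest1 a s (r + w) * x
     - gtest2 a s r * (D * x + x ^+ 2 / 2)| <= 128 * (m ^+ 2 * b / e ^+ 3).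
Proof.
move=> e0 es wm Dm xb bm; set K := 32 / e ^+ 3.
have K0 : 0 <= K by rewrite divr_ge0// exprn_ge0// ltW.
have b0 : 0 <= b by exact: le_trans xb.
have m0 : 0 <= m by exact: le_trans bm.
have T3 := taylor3 (is_derive_gtest a s) (is_derive_gtest1 a s)
  (is_derive_gtest2 a s) (fun z => gtest3_bound a z e0 es) (r + w + D) x.
have T2 := taylor2 (is_derive_gtest1 a s) (is_derive_gtest2 a s)
  (fun z => gtest3_bound a z e0 es) (r + w) D.
have L1 := gtest2_lip a r (r + w) e0 es.
have L2 := gtest2_lip a r (r + w + D) e0 es.
move: T3 T2 L1 L2; rewrite -/K.
set g0 := gtest _ _ (_ + x); set g := gtest _ _ _; set g1 := gtest1 _ _ (_ + D).
set g1' := gtest1 _ _ _; set g2 := gtest2 _ _ (_ + D);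
  set g2' := gtest2 _ _ (_ + w).
set g2'' := gtest2 _ _ r => T3 T2 L1 L2.
(* Four errors of size [32 * m ^ 2 * b / e ^ 3]: the Taylor remainder in [x], the first derivative
   moved back by [D], and the second derivative moved to [r] in both second-order terms. *)
have -> : g0 - g - g1' * x - g2'' * (D * x + x ^+ 2 / 2) =
    (g0 - g - g1 * x - g2 * (x ^+ 2 / 2)) + (g1 - g1' - g2' * D) * x
    + (g2' - g2'') * (D * x) + (g2 - g2'') * (x ^+ 2 / 2) by ring.
have -> : 128 * (m ^+ 2 * b / e ^+ 3) = K * (m ^+ 2 * b) + K * (m ^+ 2 * b)
   + K * (m ^+ 2 * b) + K * (m ^+ 2 * b) by rewrite /K; ring.
have x2 : `|x| ^+ 2 <= b ^+ 2 by rewrite lerXn2r ?nnegrE.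
have D2 : `|D| ^+ 2 <= m ^+ 2 by rewrite lerXn2r ?nnegrE.
have b2 : b ^+ 2 <= m ^+ 2 by rewrite lerXn2r ?nnegrE.
have Dx : `|D| * `|x| <= m * b by rewrite ler_pM.
apply: le_trans (ler_normD _ _) _; apply: lerD.
  apply: le_trans (ler_normD _ _) _; apply: lerD.
    apply: le_trans (ler_normD _ _) _; apply: lerD.
      apply: le_trans T3 _; rewrite ler_wpM2l// exprSr.
      by rewrite ler_pM ?exprn_ge0// (le_trans x2).
    rewrite normrM mulrA ler_pM//; apply: le_trans T2 _.
    by rewrite ler_wpM2l// -real_normK ?num_real.
  rewrite (_ : K * (m ^+ 2 * b) = K * m * (m * b)); last by ring.
  rewrite !normrM ler_pM//.
  by apply: le_trans L1 _; rewrite ler_wpM2l// [r + w - r]addrC addKr.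
rewrite normrM [`|_ / 2|]ger0_norm ?divr_ge0 ?sqr_ge0//.
apply: le_trans (_ : K * (m + m) * (m * b / 2) <= _); last by lra.
rewrite ler_pM ?divr_ge0 ?sqr_ge0//.
  apply: le_trans L2 _; rewrite ler_wpM2l//.
  rewrite (_ : _ - r = w + D); last by ring.
  by apply: le_trans (ler_normD _ _) _; exact: lerD.
rewrite ler_wpM2r// -real_normK ?num_real// (le_trans x2)// expr2.
by rewrite ler_wpM2r.
Qed.

(* Scaling through [expR v] makes the second derivative in the scale parameter
   globally bounded, unlike a scaling through the factor itself near [0]. *)
Lemma gcdf_expR_scale z v :
  `|gcdf (expR v * z) - gcdf z + v * gpdf2 z| <= 32 * v ^+ 2.
Proof.
pose f v := gcdf (expR v * z).
pose df v := expR v * z * gpdf (expR v * z).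
pose d2f v := expR v * z * gpdf (expR v * z)
  - (expR v * z) ^+ 3 * gpdf (expR v * z).
have eE (u : R) : is_derive u 1 (fun u => expR u * z) (expR u * z).
  by apply: is_derive_eq; rewrite /GRing.scale/=; ring.
have fE (u : R) : is_derive u 1 f (df u).
  have := is_derive1_comp (f := gcdf) (g := fun u => expR u * z) (x := u)
    (is_derive_gcdf _) (eE u).
  by rewrite mulrC; exact.
have dfE (u : R) : is_derive u 1 df (d2f u).
  have ? := is_derive1_comp (f := gpdf) (g := fun u => expR u * z) (x := u)
    (is_derive_gpdf _) (eE u).
  have ? : is_derive u 1 (fun u => gpdf (expR u * z)) (- (expR u * z * gpdf
    (expR u * z)) * (expR u * z)) by [].
  rewrite /df; apply: is_derive_eq.
  by rewrite /GRing.scale/= /d2f; ring.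
have d2fK u : `|d2f u| <= 32.
  rewrite /d2f; move: (expR u * z) => w.
  apply: le_trans (ler_normB _ _) _.
  rewrite (normrM w) (normrM (w ^+ 3)) (normrX 3) !(ger0_norm (gpdf_ge0 _)).
  have := @gpdf_moment _ w 1 isT; have := @gpdf_moment _ w 3 isT.
  by rewrite expr1; lra.
have := taylor2 fE dfE d2fK 0 v.
rewrite add0r /f /df expR0 !mul1r; congr (`| _ | <= _).
by rewrite /gpdf2; ring.
Qed.

(** The lower bound is [ln (1 + z) <= z] at [z = - t / (1 + t)]. *)
Lemma ln1D_sub t : `|t| <= 2^-1 -> `|ln (1 + t) - t| <= 2 * t ^+ 2.
Proof.
rewrite ler_norml => /andP[t1 t2].
have p : 0 < 1 + t by lra.
have up : ln (1 + t) <= t.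
  by have := @le_ln1Dx _ t; apply; lra.
have lo : t / (1 + t) <= ln (1 + t).
  have q : 0 < 1 + (- (t / (1 + t))).
    by rewrite (_ : 1 + _ = (1 + t)^-1) ?invr_gt0//; field; lra.
  have := @le_ln1Dx _ (- (t / (1 + t))).
  rewrite (_ : 1 + - _ = (1 + t)^-1) ?lnV ?posrE//; last by field; lra.
  by rewrite lerN2; apply; lra.
have : t - 2 * t ^+ 2 <= t / (1 + t) by rewrite ler_pdivlMr//; nra.
by rewrite ler_norml => ?; apply/andP; split; nra.
Qed.

(** As a function of [y] and the variance [s ^ 2], [gcdf (y / s)] solves the heat equation: a
    relative change [t] of the variance acts as [t / 2] times the second derivative, up to
    [O(t ^ 2)]. *)
Lemma gcdf_scale_change y s s' t :
  0 < s -> 0 < s' -> s' ^+ 2 = s ^+ 2 * (1 + t) -> `|t| <= 2^-1 ->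
  `|gcdf (y / s) - gcdf (y / s') + t / 2 * gpdf2 (y / s)| <= 48 * t ^+ 2.
Proof.
move=> s0 s'0 ss' t12.
have t1 : 0 < 1 + t by move: t12; rewrite ler_norml => /andP[]; lra.
set v := - (ln (1 + t) / 2).
have ys : y / s' = expR v * (y / s).
  rewrite (_ : expR v = s / s'); first by field; rewrite !gt_eqF.
  apply/eqP; rewrite -(@eqrXn2 _ 2) ?divr_ge0 ?expR_ge0 ?ltW// expr_div_n ss'.
  rewrite -expRM_natl /v mulrN -mulr_natl mulrCA divff//
    mulr1 expRN lnK ?posrE//.
  by apply/eqP; field; rewrite !gt_eqF.
have := gcdf_expR_scale (y / s) v; rewrite -ys; set z := y / s => H.
have L := ln1D_sub t12.
have G := gpdf2_bound z.
move: t12 H L G; rewrite /v.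
move: (gcdf z) (gcdf _) (gpdf2 z) (ln _) => A B C l.
rewrite !ler_norml => /andP[? ?] /andP[? ?] /andP[? ?] /andP[? ?].
have l2 : l ^+ 2 <= 4 * t ^+ 2.
  by have [t0|t0] := leP 0 t; [have : - (2 * t) <= l <= 2 * t|have : 2 * t <=
    l <= - (2 * t)];
    do ?[by apply/andP; split; nra]; case/andP => ? ?; nra.
have lC : - (32 * t ^+ 2) <= (l - t) * C <= 32 * t ^+ 2 by apply/andP; split;
  nra.
by case/andP: lC => ? ?; apply/andP; split; nra.
Qed.

Lemma gtest_step a s s' e r w D x m b (tau : R) :
  0 < e -> e <= s -> e <= s' -> s' ^+ 2 = s ^+ 2 + tau ->
  `|w| <= m -> `|D| <= m -> `|x| <= b -> b <= m -> `|tau| <= 5 * (m * b) ->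
  10 * (m * b) <= e ^+ 2 ->
  `|gtest a s (r + w + D + x) - gtest a s' (r + w + D) - gtest1 a s (r + w) * x
     - gtest2 a s r * (D * x + x ^+ 2 / 2 - tau / 2)|
    <= 1488 * (m ^+ 2 * b / e ^+ 3).
Proof.
move=> e0 es es' ss' wm Dm xb bm taub mbe.
have s0 : 0 < s by exact: lt_le_trans es.
have s'0 : 0 < s' by exact: lt_le_trans es'.
have b0 : 0 <= b by exact: le_trans xb.
have m0 : 0 <= m by exact: le_trans bm.
have be : b <= e.
  by rewrite -(@ler_pXn2r _ 2) ?nnegrE ?(ltW e0)//; have := ler_wpM2r b0 bm;
    rewrite -expr2; have := mulr_ge0 m0 b0; lra.
have es2 : e ^+ 2 <= s ^+ 2 by rewrite lerXn2r ?nnegrE ?(ltW e0) ?(ltW s0).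
pose t := tau / s ^+ 2.
have tau_t : `|t| <= 5 * (m * b) / e ^+ 2.
  rewrite /t normrM normfV (ger0_norm (sqr_ge0 s)).
  rewrite ler_pM ?invr_ge0 ?sqr_ge0// lef_pV2// posrE exprn_gt0//.
have t12 : `|t| <= 2^-1.
  by apply: le_trans tau_t _; rewrite ler_pdivrMr ?exprn_gt0//; lra.
have s't : s' ^+ 2 = s ^+ 2 * (1 + t).
  by rewrite ss' /t; field; rewrite gt_eqF.
set y := a - (r + w + D).
have S := gcdf_scale_change y s0 s'0 s't t12.
have I := gtest_increment a r e0 es wm Dm xb bm.
have L := gtest2_lip a r (r + w + D) e0 es.
have {S} S : `|gtest a s (r + w + D) - gtest a s' (r + w + D)
    + tau / 2 * gtest2 a s (r + w + D)| <= 1200 * (m ^+ 2 * b / e ^+ 3).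
  have -> : tau / 2 * gtest2 a s (r + w + D) = t / 2 * gpdf2 (y / s).
    by rewrite /gtest2 /t -/y; field; rewrite gt_eqF.
  apply: le_trans S _; rewrite -real_normK ?num_real//.
  apply: le_trans (_ : 48 * (5 * (m * b) / e ^+ 2) ^+ 2 <= _).
    by rewrite ler_wpM2l// lerXn2r ?nnegrE// (le_trans _ tau_t).
  have K0 : 0 <= m ^+ 2 * b / e ^+ 3.
    by apply: divr_ge0; [apply: mulr_ge0 => //;
      exact: sqr_ge0|apply: exprn_ge0; exact: ltW].
  have be1 : b / e <= 1 by rewrite ler_pdivrMr// mul1r.
  (* The spare factor [b / e] is at most [1]. *)
  rewrite (_ : 48 * _ = 1200 * (m ^+ 2 * b / e ^+ 3 * (b / e))); last first.
    by field; rewrite gt_eqF.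
  have := ler_wpM2l K0 be1; rewrite mulr1.
  by move: (_ / e ^+ 3) (_ / e) => K c; lra.
have {L} L : `|tau / 2 * (gtest2 a s (r + w + D) - gtest2 a s r)|
    <= 160 * (m ^+ 2 * b / e ^+ 3).
  rewrite normrM; apply: le_trans (_ : (5 * (m * b) / 2) * (32 / e ^+ 3 * (m +
    m)) <= _).
    rewrite ler_pM//; first by rewrite normrM [`|2^-1|]ger0_norm// ler_wpM2r.
    apply: le_trans L _; rewrite ler_wpM2l ?divr_ge0 ?exprn_ge0 ?(ltW e0)//.
    rewrite (_ : _ - r = w + D); last by ring.
    by apply: le_trans (ler_normD _ _) _; exact: lerD.
  by rewrite le_eqVlt; apply/orP; left; apply/eqP; field; rewrite gt_eqF.
move: S I L; move: (gtest a s (_ + x)) (gtest a s _) (gtest a s' _) (gtest1 _ _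
  _).
move: (gtest2 a s (_ + D)) (gtest2 a s r) (m ^+ 2 * b / e ^+ 3) => g2 g2' K g0
  g g' g1 S I L.
rewrite (_ : g0 - g' - _ - _ = (g0 - g - g1 * x - g2' * (D * x + x ^+ 2 / 2))
   + (g - g' + tau / 2 * g2) - tau / 2 * (g2 - g2')); last by field.
apply: le_trans (ler_normB _ _) _.
by have := ler_normD (g0 - g - g1 * x - g2' * (D * x + x ^+ 2 / 2)) (g - g' +
  tau / 2 * g2); lra.
Qed.

End gaussian_test_functions.
(* The expectation is abstracted into a positive normalized linear functional
   on an algebra of functions. *)
Record mean_operator (R : realType) (T : Type) := MeanOperator {
  mdom : (T -> R) -> Prop;
  mean : (T -> R) -> R;
  mdom_cst : forall c, mdom (fun=> c);
  mdomD : forall f g, mdom f -> mdom g -> mdom (fun x => f x + g x);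
  mdomM : forall f g, mdom f -> mdom g -> mdom (fun x => f x * g x);
  mdom_comp : forall (h : R -> R) f, continuous h -> mdom f ->
    mdom (fun x => h (f x));
  mean_cst : forall c, mean (fun=> c) = c;
  meanD : forall f g, mdom f -> mdom g ->
    mean (fun x => f x + g x) = mean f + mean g;
  meanZ : forall c f, mdom f -> mean (fun x => c * f x) = c * mean f;
  mean_le : forall f g, mdom f -> mdom g -> (forall x, f x <= g x) ->
    mean f <= mean g }.

(** * Means as positive linear functionals *)

Section mean_operator_theory.
Context {R : realType} {T : Type} (E : mean_operator R T).
Implicit Types (f g : T -> R).

Lemma mdomZ c f : mdom E f -> mdom E (fun x => c * f x).
Proof. by move=> df; apply: mdomM => //; exact: mdom_cst. Qed.

Lemma mdomN f : mdom E f -> mdom E (fun x => - f x).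
Proof.
move=> /(mdomZ (-1)); congr mdom.
by apply/funext => x; rewrite mulN1r.
Qed.

Lemma mdomB f g : mdom E f -> mdom E g -> mdom E (fun x => f x - g x).
Proof. by move=> df dg; apply: mdomD => //; exact: mdomN. Qed.

Lemma mdomX f n : mdom E f -> mdom E (fun x => f x ^+ n).
Proof.
move=> df; elim: n => [|n IH]; first by under eq_fun do rewrite expr0;
  exact: mdom_cst.
by under eq_fun do rewrite exprS; exact: mdomM.
Qed.

Lemma mdom_sum (I : Type) (r : seq I) (F : I -> T -> R) :
  (forall i, mdom E (F i)) -> mdom E (fun x => \sum_(i <- r) F i x).
Proof.
move=> dF; elim: r => [|i r IH].
  by under eq_fun do rewrite big_nil; exact: mdom_cst.
by under eq_fun do rewrite big_cons; exact: mdomD.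
Qed.

Lemma meanN f : mdom E f -> mean E (fun x => - f x) = - mean E f.
Proof.
move=> df; rewrite -[RHS]mulN1r -meanZ//; congr mean.
by apply/funext => x; rewrite mulN1r.
Qed.

Lemma meanB f g : mdom E f -> mdom E g ->
  mean E (fun x => f x - g x) = mean E f - mean E g.
Proof. by move=> df dg; rewrite meanD ?meanN//; exact: mdomN. Qed.

Lemma mean_sum (I : Type) (r : seq I) (F : I -> T -> R) :
  (forall i, mdom E (F i)) ->
  mean E (fun x => \sum_(i <- r) F i x) = \sum_(i <- r) mean E (F i).
Proof.
move=> dF; elim: r => [|i r IH].
  by under eq_fun do rewrite big_nil; rewrite mean_cst big_nil.
under eq_fun do rewrite big_cons.
by rewrite meanD// ?IH ?big_cons//; exact: mdom_sum.
Qed.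

Lemma mean_norm_le f K : mdom E f -> (forall x,
  `|f x| <= K) -> `|mean E f| <= K.
Proof.
move=> df fK; rewrite ler_norml; apply/andP; split.
  rewrite -(mean_cst E (- K)); apply: mean_le => //; first exact: mdom_cst.
  by move=> x; have := fK x; rewrite ler_norml => /andP[].
rewrite -[leRHS](mean_cst E K); apply: mean_le => //; first exact: mdom_cst.
by move=> x; have := fK x; rewrite ler_norml => /andP[].
Qed.

Lemma mean_ge0 f : mdom E f -> (forall x, 0 <= f x) -> 0 <= mean E f.
Proof.
by move=> df f0; rewrite -(mean_cst E 0); apply: mean_le => //; exact: mdom_cst.
Qed.

End mean_operator_theory.

Lemma ler_norm_sum_nat (R : numDomainType) (m n : nat) (F : nat -> R) (c : R) :
  (forall j, (m <= j < n)%N -> `|F j| <= c) ->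
  `|\sum_(m <= j < n) F j| <= (n - m)%:R * c.
Proof.
move=> Fc; apply: le_trans (ler_norm_sum _ _ _) _.
apply: le_trans (_ : \sum_(m <= j < n) c <= _).
  by rewrite ler_sum_nat.
by rewrite sumr_const_nat mulr_natl.
Qed.

(** * Partial sums and decorrelation at distance [M] *)

Definition psum {R : realType} {T : Type} (X : nat -> T -> R) n x : R :=
  \sum_(1 <= k < n.+1) X k x.

(** The class fits both sides: composing a sum with such a [g] multiplies the bound on its variation
    by [L], and [gtest1], [gtest2] have constants of order [e ^ -2], [e ^ -3]. *)
Definition lipschitz_with {R : realType} (L : R) (g : R -> R) :=
  forall x y, `|g y - g x| <= L * `|y - x|.

(* The subtraction [k - M] is truncated: for [k <= M] the bound only concerns
   [psum X 0 = 0], and amounts to a bound on the mean of [X k]. *)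
Definition decorrelated1 {R : realType} {T : Type} (E : mean_operator R T)
    (N M : nat) (X : nat -> T -> R) (kap : R) :=
  forall g L j k, lipschitz_with L g -> (1 <= k)%N -> (k <= N)%N ->
  (j <= k - M)%N ->
  `|mean E (fun x => g (psum X j x) * X k x)| <= L * kap.

(** Subtracting the product of means amounts to centering the test function. Only the smaller index
    [j] has to be far from [i], so [j] and [k] may be close or equal. *)
Definition decorrelated2 {R : realType} {T : Type} (E : mean_operator R T)
    (N M : nat) (X : nat -> T -> R) (kap : R) :=
  forall g L i j k, lipschitz_with L g ->
  (1 <= j)%N -> (j <= k)%N -> (k <= N)%N -> (i <= j - M)%N ->
  `|mean E (fun x => g (psum X i x) * (X j x * X k x))
    - mean E (fun x => g (psum X i x)) * mean E (fun x => X j x * X k x)|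
    <= L * kap.

Lemma lipschitz_with_continuous {R : realType} (L : R) (g : R -> R) :
  lipschitz_with L g -> continuous g.
Proof.
move=> gL x; apply/cvgrPdist_le => /= e e0.
have L1 : 0 < `|L| + 1 by rewrite ltr_wpDl.
near=> y; rewrite distrC; apply: le_trans (gL x y) _.
apply: le_trans (_ : (`|L| + 1) * `|y - x| <= _).
  by rewrite ler_wpM2r// (le_trans (ler_norm L))// lerDl.
rewrite -ler_pdivlMl// distrC; near: y.
by apply: cvgr_dist_le; [exact: cvg_id|rewrite mulr_gt0// invr_gt0].
Unshelve. all: by end_near. Qed.

(** The two freezing points of the summand [k.+1]. Truncated subtraction keeps the bounds valid at
    the start of the sum. *)
Lemma window_bounds (k M : nat) : (0 < M)%N ->
  [/\ (k.+1 - M.*2 <= k.+1 - M)%N, (k.+1 - M - (k.+1 - M.*2) <= M)%N,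
      (k.+1 - M <= k)%N & (k - (k.+1 - M) <= M)%N].
Proof. by move=> M0; rewrite -addnn; split; lia. Qed.

(** * Covariances and variances of the partial sums *)

Section lindeberg.
Context {R : realType} {T : Type} (E : mean_operator R T).
Variables (N M : nat) (X : nat -> T -> R) (b kap : R).
Hypothesis M_gt0 : (0 < M)%N.
Hypothesis b_ge0 : 0 <= b.
Hypothesis kap_ge0 : 0 <= kap.
Hypothesis dX : forall k, mdom E (X k).
Hypothesis Xb : forall k x, `|X k x| <= b.
Hypothesis dec1 : decorrelated1 E N M X kap.
Hypothesis dec2 : decorrelated2 E N M X kap.
Local Notation psum := (psum X).

Lemma psum_dom n : mdom E (psum n).
Proof. exact: mdom_sum. Qed.

Lemma psum0 x : psum 0 x = 0.
Proof. by rewrite /psum big_geq. Qed.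

Lemma psumS n x : psum n.+1 x = psum n x + X n.+1 x.
Proof. by rewrite /psum big_nat_recr. Qed.

Lemma psum_sub m n x : (m <= n)%N ->
  psum n x - psum m x = \sum_(m.+1 <= j < n.+1) X j x.
Proof.
by move=> mn; rewrite /psum (@big_cat_nat _ _ _ m.+1)//= [X in X - _]addrC
  addrK.
Qed.

Lemma psum_incr m n p x : (m <= n)%N -> (n - m <= p)%N ->
  `|psum n x - psum m x| <= p%:R * b.
Proof.
move=> mn nmp; rewrite psum_sub//.
apply: le_trans (ler_norm_sum_nat (c := b) _) _ => //.
by rewrite subSS ler_wpM2r// ler_nat.
Qed.

Definition variance_at (k : nat) := mean E (fun x => psum k x ^+ 2).

Lemma variance_at0 : variance_at 0 = 0.
Proof.
by rewrite /variance_at; under eq_fun do rewrite psum0 expr0n/=;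
  rewrite mean_cst.
Qed.

Lemma variance_at_split k (Z : T -> R) : mdom E Z ->
  mean E (fun x => (psum k x + Z x) ^+ 2) =
  variance_at k + mean E (fun x => Z x ^+ 2) + 2 * mean E (fun x => psum k x *
    Z x).
Proof.
move=> dZ; have dk := psum_dom k.
under eq_fun do rewrite sqrrD addrAC -mulr_natl.
rewrite meanD ?meanZ ?meanD//; do ?[exact: mdomX|exact: mdomM].
  by apply: mdomD; exact: mdomX.
by apply: mdomZ; exact: mdomM.
Qed.

Lemma cov_far k j : (1 <= j)%N -> (j <= N)%N -> (k <= j - M)%N ->
  `|mean E (fun x => psum k x * X j x)| <= kap.
Proof.
move=> j1 jN kj; rewrite -[leRHS]mul1r.
by apply: (dec1 (g := id)) => // x y; rewrite mul1r.
Qed.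

(** [psum k] is cut at [j - M]: the recent part has at most [M] terms and is bounded crudely, the
    remote part is decorrelated from [X j]. *)
Lemma cov_near k j : (k < j)%N -> (j <= N)%N ->  (j <= k + M)%N ->
  `|mean E (fun x => psum k x * X j x)| <= M%:R * b ^+ 2 + kap.
Proof.
move=> kj jN jkM; have dk := psum_dom k; have dj := psum_dom (j - M).
have -> : mean E (fun x => psum k x * X j x) =
    mean E (fun x => (psum k x - psum (j - M) x) * X j x)
    + mean E (fun x => psum (j - M) x * X j x).
  rewrite -meanD; do ?[exact: mdomM|apply: mdomM => //; exact: mdomB].
  by congr mean; apply/funext => x; ring.
apply: le_trans (ler_normD _ _) _; apply: lerD; last by apply: cov_far => //;
  lia.
apply: mean_norm_le; first by apply: mdomM => //; exact: mdomB.
move=> x; rewrite normrM expr2 mulrA ler_pM//.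
by apply: psum_incr; lia.
Qed.

(** The variance of the remaining sum is nonnegative, so an excess over [variance_at N] can only
    come from its covariance with [psum k]. There the next [M] summands cost [M * b ^ 2 + kap] each,
    the others [kap]. *)
Lemma variance_at_upper k : (k <= N)%N ->
  variance_at k <= variance_at N + 2 * (M%:R * (M%:R * b ^+ 2 + kap) + N%:R *
    kap).
Proof.
move=> kN; pose Z x := \sum_(k.+1 <= j < N.+1) X j x.
have dZ : mdom E Z by exact: mdom_sum.
have dk := psum_dom k.
have EN : variance_at N =
    variance_at k + mean E (fun x => Z x ^+ 2) + 2 * mean E (fun x => psum k x
      * Z x).
  rewrite -variance_at_split//; congr mean; apply/funext => x.
  by rewrite /Z -psum_sub// addrC subrK.
have Z0 : 0 <= mean E (fun x => Z x ^+ 2).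
  by apply: mean_ge0; [exact: mdomX|move=> x; exact: sqr_ge0].
suff : `|mean E (fun x => psum k x * Z x)|
    <= M%:R * (M%:R * b ^+ 2 + kap) + N%:R * kap.
  rewrite ler_norml => /andP[]; move: EN Z0.
  move: (variance_at N) (variance_at k) (mean _ _) (mean _ _) (M%:R * _ + _).
  by move=> ? ? ? ? ?; lra.
have -> : mean E (fun x => psum k x * Z x) =
    \sum_(k.+1 <= j < N.+1) mean E (fun x => psum k x * X j x).
  rewrite -mean_sum; last by move=> j; exact: mdomM.
  by congr mean; apply/funext => x; rewrite /Z big_distrr.
set W := minn (k + M) N.
have kW : (k <= W)%N by rewrite /W; lia.
rewrite (@big_cat_nat _ _ _ W.+1)//=; last by rewrite /W; lia.
apply: le_trans (ler_normD _ _) _; apply: lerD.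
  apply: le_trans (ler_norm_sum_nat (c := M%:R * b ^+ 2 + kap) _) _.
    by move=> j jW; apply: cov_near; rewrite /W in jW *; lia.
  rewrite ler_wpM2r ?addr_ge0 ?mulr_ge0 ?exprn_ge0// ler_nat /W; lia.
apply: le_trans (ler_norm_sum_nat (c := kap) _) _.
  by move=> j jW; apply: cov_far; rewrite /W in jW *; lia.
by rewrite ler_wpM2r// ler_nat; lia.
Qed.

Lemma cov_window (g : R -> R) L k : lipschitz_with L g -> (k < N)%N ->
  `|mean E (fun x => g (psum (k.+1 - M.*2) x)
        * ((psum k x - psum (k.+1 - M) x) * X k.+1 x))
    - mean E (fun x => g (psum (k.+1 - M.*2) x))
      * mean E (fun x => (psum k x - psum (k.+1 - M) x) * X k.+1 x)|
    <= M%:R * (L * kap).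
Proof.
pose G x := g (psum (k.+1 - M.*2) x).
pose D x := psum k x - psum (k.+1 - M) x.
move=> gL kN; rewrite -/G -/(D _).
have L0 : 0 <= L * kap.
  by rewrite mulr_ge0// -[leRHS]mulr1 -[X in _ * X]normr1 -[X in `|X|]subr0
    (le_trans _ (gL 0 1)).
have dG : mdom E G.
  by apply: mdom_comp (psum_dom _); exact: lipschitz_with_continuous gL.
have DE x : D x = \sum_((k.+1 - M).+1 <= j < k.+1) X j x.
  by rewrite /D psum_sub//; lia.
have -> : mean E (fun x => G x * (D x * X k.+1 x)) =
    \sum_((k.+1 - M).+1 <= j < k.+1) mean E (fun x => G x * (X j x * X k.+1 x)).
  rewrite -mean_sum; last by move=> j; do 2?apply: mdomM.
  by congr mean; apply/funext => x; rewrite DE big_distrl big_distrr.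
have -> : mean E (fun x => D x * X k.+1 x) =
    \sum_((k.+1 - M).+1 <= j < k.+1) mean E (fun x => X j x * X k.+1 x).
  rewrite -mean_sum; last by move=> j; apply: mdomM.
  by congr mean; apply/funext => x; rewrite DE big_distrl.
rewrite big_distrr -sumrB.
apply: le_trans (ler_norm_sum_nat (c := L * kap) _) _.
  by move=> j jk; apply: dec2 => //; rewrite -?addnn; lia.
by rewrite ler_wpM2r// ler_nat; lia.
Qed.

(** * The smoothing scales and one replacement step *)

Variable e : R.
Hypothesis N_gt0 : (0 < N)%N.
Hypothesis e_gt0 : 0 < e.
Hypothesis e_le : e <= 2^-1.
Hypothesis window_small : 10 * (M%:R * b) ^+ 2 <= e ^+ 2.
Hypothesis kap_small : N%:R * kap <= b ^+ 3.
Hypothesis variance1 : variance_at N = 1.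
Let m := M%:R * b.

Let b_le_m : b <= m.
Proof. by rewrite ler_peMl// ler1n. Qed.

Let m_ge0 : 0 <= m.
Proof. exact: le_trans b_le_m. Qed.

Let b_le1 : b <= 1.
Proof.
have e1 : e ^+ 2 <= 1 by have := e_gt0; have := e_le; nra.
rewrite -(@ler_pXn2r _ 2) ?nnegrE ?expr1n//.
have : b ^+ 2 <= m ^+ 2 by rewrite lerXn2r ?nnegrE.
by have := sqr_ge0 m; move: window_small e1; rewrite -/m; lra.
Qed.

Let b3_le : b ^+ 3 <= m * b.
Proof.
rewrite exprSr ler_wpM2r// expr2 (le_trans _ b_le_m)//.
by rewrite ler_piMr.
Qed.

Let mb_le : m * b <= m ^+ 2.
Proof. by rewrite expr2 ler_wpM2l. Qed.

Let window10 : 10 * (m * b) <= e ^+ 2.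
Proof. by apply: le_trans window_small; rewrite ler_wpM2l// mb_le. Qed.

Let e_le1 : e <= 1.
Proof. by apply: le_trans e_le _; rewrite invf_le1 ?ler1n// ltr0n. Qed.

Let kap_le : kap <= b ^+ 3.
Proof.
by apply: le_trans kap_small; rewrite ler_peMl// ler1n.
Qed.

Let Mkap_le : M%:R * kap <= m ^+ 2 * b.
Proof.
apply: le_trans (_ : M%:R * b ^+ 3 <= _); first by rewrite ler_wpM2l.
have -> : m ^+ 2 * b = M%:R * (M%:R * b ^+ 3) by rewrite /m; ring.
by rewrite ler_wpM2l// ler_peMl ?exprn_ge0// ler1n.
Qed.

Definition smoothing_scale (k : nat) : R :=
  Num.sqrt (2 * e ^+ 2 + 1 - variance_at k).

(** The bound on the variances gives [variance_at k <= 1 + 6 * m ^ 2 <= 1 + e ^ 2], so half of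
    [2 * e ^ 2] absorbs the excess. *)
Let scale_arg k : (k <= N)%N -> e ^+ 2 <= 2 * e ^+ 2 + 1 - variance_at k.
Proof.
move=> kN; have := variance_at_upper kN; rewrite variance1.
have -> : M%:R * (M%:R * b ^+ 2 + kap) = m ^+ 2 + M%:R * kap by rewrite /m;
  ring.
have := Mkap_le; have : m ^+ 2 * b <= m ^+ 2 by rewrite ler_piMr ?sqr_ge0.
move: window_small kap_small b3_le mb_le; rewrite -/m.
have := sqr_ge0 e; move: (M%:R * kap) (N%:R * kap) (variance_at k) (m ^+ 2 * b).
by move: (m ^+ 2) (m * b) (b ^+ 3) (e ^+ 2) => *; lra.
Qed.

Lemma smoothing_scale_sqr k : (k <= N)%N ->
  smoothing_scale k ^+ 2 = 2 * e ^+ 2 + 1 - variance_at k.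
Proof.
by move=> kN; rewrite sqr_sqrtr// (le_trans _ (scale_arg kN))// sqr_ge0.
Qed.

Lemma smoothing_scale_ge k : (k <= N)%N -> e <= smoothing_scale k.
Proof.
move=> kN; rewrite -(@ler_pXn2r _ 2) ?nnegrE ?sqrtr_ge0 ?(ltW e_gt0)//.
by rewrite smoothing_scale_sqr// scale_arg.
Qed.

Lemma variance_increment k : (k < N)%N ->
  variance_at k.+1 - variance_at k =
  mean E (fun x => X k.+1 x * X k.+1 x) + 2 * mean E (fun x => psum k x * X
    k.+1 x).
Proof.
move=> kN.
have -> : variance_at k.+1 = variance_at k
    + mean E (fun x => X k.+1 x ^+ 2) + 2 * mean E (fun x => psum k x * X k.+1
      x).
  rewrite -variance_at_split//; congr mean; apply/funext => x.
  by rewrite psumS.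
have -> : mean E (fun x => X k.+1 x ^+ 2) = mean E (fun x => X k.+1 x * X k.+1
  x).
  by congr mean; apply/funext => x; rewrite expr2.
by rewrite -[X in X - _]addrA addrAC subrr add0r.
Qed.

(** The square contributes [m * b]; the covariance is at most [m * b + kap <= 2 * (m * b)] and
    counts twice. *)
Lemma variance_increment_le k : (k < N)%N ->
  `|variance_at k.+1 - variance_at k| <= 5 * (m * b).
Proof.
move=> kN; rewrite variance_increment//.
have XX : `|mean E (fun x => X k.+1 x * X k.+1 x)| <= m * b.
  apply: mean_norm_le; first exact: mdomM.
  by move=> x; rewrite normrM ler_pM// (le_trans (Xb _ _)).
have := @cov_near k k.+1 (ltnSn k) kN _.
rewrite addnC -addn1 addnC leq_add2r => /(_ M_gt0).
have -> : M%:R * b ^+ 2 = m * b by rewrite /m; ring.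
move: XX kap_le b3_le; move: (mean _ _) (mean _ _) (m * b) => u v w.
move=> XX K1 K2 C1; apply: le_trans (ler_normD _ _) _.
rewrite normrM (ger0_norm (ler0n _ 2)).
by lra.
Qed.

Let gtest_dom a s k : mdom E (fun x => gtest a s (psum k x)).
Proof.
apply: (mdom_comp (h := gtest a s)); last exact: psum_dom.
exact: is_derive_continuous (is_derive_gtest a s).
Qed.

Let gtest1_dom a s k : mdom E (fun x => gtest1 a s (psum k x)).
Proof.
apply: (mdom_comp (h := gtest1 a s)); last exact: psum_dom.
exact: is_derive_continuous (is_derive_gtest1 a s).
Qed.

Let gtest2_dom a s k : mdom E (fun x => gtest2 a s (psum k x)).
Proof.
apply: (mdom_comp (h := gtest2 a s)); last exact: psum_dom.
exact: is_derive_continuous (is_derive_gtest2 a s).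
Qed.

(** Here the second-order terms cancel: as [tau] is the variance increment,
    [d + h / 2 - tau / 2 * g] is a combination of decorrelation errors. The constant is
    [1488 + 16 + 32 + 16 + 16]. *)
Let step_arith (A p p' c d h g mD mX mQ tau B Mk K : R) :
  A = (p - p' - c) - (d + 2^-1 * h - tau / 2 * g) ->
  tau = mX + 2 * (mD + mQ) -> `|A| <= 1488 * B -> `|c| <= 16 * K ->
  `|d - g * mD| <= 32 * Mk -> `|h - g * mX| <= 32 * K -> `|g * mQ| <= 16 * K ->
  Mk <= B -> K <= Mk -> `|p - p'| <= 1568 * B.
Proof.
move=> -> ->; rewrite !ler_norml => /andP[? ?] /andP[? ?] /andP[? ?] /andP[? ?].
move=> /andP[? ?] ? ?; apply/andP; split; lra.
Qed.

Lemma lindeberg_step a k : (k < N)%N ->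
  `|mean E (fun x => gtest a (smoothing_scale k.+1) (psum k.+1 x))
    - mean E (fun x => gtest a (smoothing_scale k) (psum k x))|
  <= 1568 * (m ^+ 2 * b / e ^+ 3).
Proof.
move=> kN.
have [i1 i2 i3 i4] := window_bounds k M_gt0.
set s := smoothing_scale k.+1; set s' := smoothing_scale k.
have es : e <= s by exact: smoothing_scale_ge.
have es' : e <= s' by apply: smoothing_scale_ge; exact: ltnW.
have ss' : s' ^+ 2 = s ^+ 2 + (variance_at k.+1 - variance_at k).
  by rewrite /s /s' !smoothing_scale_sqr ?(ltnW kN)//; ring.
have taub := variance_increment_le kN.
have tauE := variance_increment kN.
set tau := variance_at k.+1 - _ in ss' taub tauE.
pose Q x := psum (k.+1 - M) x; pose r x := psum (k.+1 - M.*2) x.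
pose D x := psum k x - Q x; pose x1 := X k.+1.
pose G x := gtest2 a s (r x); pose G1 x := gtest1 a s (Q x).
have dQ : mdom E Q by exact: psum_dom.
have dD : mdom E D by apply: mdomB; exact: psum_dom.
have dG : mdom E G by exact: gtest2_dom.
have dG1 : mdom E G1 by exact: gtest1_dom.
have dx1 : mdom E x1 by exact: dX.
have dDx : mdom E (fun x => D x * x1 x) by exact: mdomM.
have dxx : mdom E (fun x => x1 x * x1 x) by exact: mdomM.
have dQx : mdom E (fun x => Q x * x1 x) by exact: mdomM.
have dGDx : mdom E (fun x => G x * (D x * x1 x)) by exact: mdomM.
have dGxx : mdom E (fun x => G x * (x1 x * x1 x)) by exact: mdomM.
have dGxx2 : mdom E (fun x => 2^-1 * (G x * (x1 x * x1 x))) by exact: mdomZ.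
have dG1x : mdom E (fun x => G1 x * x1 x) by exact: mdomM.
have dtG : mdom E (fun x => tau / 2 * G x) by exact: mdomZ.
have dg := gtest_dom a s k.+1; have dg' := gtest_dom a s' k.
have dgg := mdomB dg dg'; have dggg := mdomB dgg dG1x.
have dGG := mdomB (mdomD dGDx dGxx2) dtG.
(* The error of [gtest_step] with its products expanded, so that its mean splits into terms within
   reach of [dec1] and [dec2]. *)
pose A x := (gtest a s (psum k.+1 x) - gtest a s' (psum k x) - G1 x * x1 x)
  - (G x * (D x * x1 x) + 2^-1 * (G x * (x1 x * x1 x)) - tau / 2 * G x).
have mA : mean E A = (mean E (fun x => gtest a s (psum k.+1 x))
    - mean E (fun x => gtest a s' (psum k x)) - mean E (fun x => G1 x * x1 x))
    - (mean E (fun x => G x * (D x * x1 x)) + 2^-1 * mean E (fun x => G x * (x1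
      x * x1 x))
      - tau / 2 * mean E G).
  rewrite /A (meanB dggg dGG) (meanB dgg dG1x) (meanB dg dg').
  by rewrite (meanB (mdomD dGDx dGxx2) dtG) (meanD dGDx dGxx2) !meanZ.
have Ab : `|mean E A| <= 1488 * (m ^+ 2 * b / e ^+ 3).
  apply: mean_norm_le => [|x]; first exact: mdomB.
  have H := @gtest_step _ a s s' e (r x) (Q x - r x) (D x) (x1 x) m b tau e_gt0
    es es' ss'.
  have : A x = gtest a s (r x + (Q x - r x) + D x + x1 x)
     - gtest a s' (r x + (Q x - r x) + D x) - gtest1 a s (r x + (Q x - r x)) *
       x1 x
     - gtest2 a s (r x) * (D x * x1 x + x1 x ^+ 2 / 2 - tau / 2).
    have -> : r x + (Q x - r x) = Q x by ring.
    have -> : Q x + D x = psum k x by rewrite /D; ring.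
    rewrite /A -/(G1 x) -/(G x) psumS -/x1.
    by congr (_ - _); field.
  move=> ->; apply: H.
  - exact: psum_incr x i1 i2.
  - exact: psum_incr x i3 i4.
  - exact: Xb.
  - exact: b_le_m.
  - exact: taub.
  - exact: window10.
have C1 : `|mean E (fun x => G1 x * x1 x)| <= 16 / e ^+ 2 * kap.
  apply: dec1 => //; move=> x y; exact: gtest1_lip.
have C2 : `|mean E (fun x => Q x * x1 x)| <= kap by apply: cov_far.
have C3 := cov_window (fun x y => gtest2_lip a x y e_gt0 es) kN.
have C4 := dec2 (fun x y => gtest2_lip a x y e_gt0 es) (ltn0Sn k) (leqnn _) kN
  i1.
have C5 : `|mean E G| <= 16 / e ^+ 2.
  by apply: mean_norm_le => // x; exact: gtest2_bound.
have TX : mean E (fun x => psum k x * X k.+1 x) =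
    mean E (fun x => D x * x1 x) + mean E (fun x => Q x * x1 x).
  rewrite -meanD//; congr mean; apply/funext => x.
  by rewrite -mulrDl /D subrK.
rewrite TX in tauE; move: C3 C4 Ab tauE.
rewrite -/Q -/r -/x1 -/(D _) -/(G _) mA.
have E3 : 16 / e ^+ 2 * kap <= 16 * (kap / e ^+ 3).
  rewrite mulrAC -mulrA ler_wpM2l// ler_wpM2l// lef_pV2 ?posrE ?exprn_gt0//.
  by rewrite exprSr ler_piMr ?exprn_ge0 ?(ltW e_gt0).
have E5 : M%:R * (kap / e ^+ 3) <= m ^+ 2 * b / e ^+ 3.
  by rewrite mulrA ler_wpM2r// invr_ge0 exprn_ge0 ?(ltW e_gt0).
have E6 : kap / e ^+ 3 <= M%:R * (kap / e ^+ 3).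
  by rewrite ler_peMl ?ler1n// divr_ge0 ?exprn_ge0 ?(ltW e_gt0).
have E7 : `|mean E G * mean E (fun x => Q x * x1 x)| <= 16 * (kap / e ^+ 3).
  by apply: le_trans E3; rewrite normrM ler_pM.
have E8 : 32 / e ^+ 3 * kap = 32 * (kap / e ^+ 3) by rewrite mulrAC mulrA.
have E9 : M%:R * (32 / e ^+ 3 * kap) = 32 * (M%:R * (kap / e ^+ 3)).
  by rewrite E8 mulrCA.
rewrite E9 E8 => C3 C4 Ab tauE.
exact: (step_arith erefl tauE Ab (le_trans C1 E3) C3 C4 E7 E5 E6).
Qed.

Lemma gcdf_lip x y : `|gcdf y - gcdf x| <= 16 * `|y - x| :> R.
Proof. exact: lipschitz_of_deriv is_derive_gcdf gpdf_bound _ _. Qed.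

Lemma lindeberg_sum a :
  `|mean E (fun x => gtest a (smoothing_scale N) (psum N x))
    - mean E (fun x => gtest a (smoothing_scale 0) (psum 0 x))|
  <= N%:R * (1568 * (m ^+ 2 * b / e ^+ 3)).
Proof.
have step k : (k < N)%N -> _ := @lindeberg_step a k.
move: step; move: (1568 * _) => B step.
suff : forall n, (n <= N)%N ->
  `|mean E (fun x => gtest a (smoothing_scale n) (psum n x))
    - mean E (fun x => gtest a (smoothing_scale 0) (psum 0 x))|
  <= n%:R * B by apply.
elim=> [_|n IH nN]; first by rewrite subrr normr0 mul0r.
rewrite -(subrK (mean E (fun x => gtest a (smoothing_scale n) (psum n x)))
  (mean E (fun x => gtest a (smoothing_scale n.+1) (psum n.+1 x)))) -addrA.
apply: le_trans (ler_normD _ _) _.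
rewrite -natr1 mulrDl mul1r [leRHS]addrC.
by apply: lerD; [exact: step|apply: IH; exact: ltnW].
Qed.

Lemma lindeberg_gcdf a :
  `|mean E (fun x => gtest a (smoothing_scale N) (psum N x)) - gcdf a|
  <= N%:R * (1568 * (m ^+ 2 * b / e ^+ 3)) + 64 * e ^+ 2.
Proof.
rewrite -(subrK (mean E (fun x => gtest a (smoothing_scale 0) (psum 0 x)))
  (mean E (fun x => gtest a (smoothing_scale N) (psum N x)))) -addrA.
apply: le_trans (ler_normD _ _) _.
have := lindeberg_sum a; move: (1568 * _) => B HB; apply: lerD; first exact: HB.
have -> : mean E (fun x => gtest a (smoothing_scale 0) (psum 0 x))
    = gcdf (a / smoothing_scale 0).
  under eq_fun do rewrite psum0 /gtest subr0.
  exact: mean_cst.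
have s2 : smoothing_scale 0 ^+ 2 = 1 ^+ 2 * (1 + 2 * e ^+ 2).
  by rewrite smoothing_scale_sqr// variance_at0; ring.
have s0 : 0 < smoothing_scale 0 by rewrite (lt_le_trans e_gt0)//
  smoothing_scale_ge.
have e2 : e ^+ 2 <= 4^-1 by have := e_gt0; have := e_le; nra.
have t12 : `|2 * e ^+ 2| <= 2^-1.
  have e20 := sqr_ge0 e; rewrite ger0_norm; first by move: e2;
    move: (e ^+ 2) => *; lra.
  exact: mulr_ge0.
(* With [t = 2 * e ^ 2], the error [48 * t ^ 2] is at most [48 * e ^ 2] because [e ^ 2 <= 1 / 4],
   and the first-order term is at most [16 * e ^ 2]. *)
have := gcdf_scale_change a ltr01 s0 s2 t12.
rewrite divr1 (_ : 2 * e ^+ 2 / 2 = e ^+ 2); last by field.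
have := gpdf2_bound a; have := sqr_ge0 e; move: e2.
move: (e ^+ 2) (gpdf2 a) (gcdf a) (gcdf _) => w g A A' w4 w0.
rewrite !ler_norml => /andP[? ?] /andP[? ?].
by apply/andP; split; nra.
Qed.

Lemma smoothing_scaleN : smoothing_scale N <= 2 * e.
Proof.
rewrite -(@ler_pXn2r _ 2) ?nnegrE ?sqrtr_ge0 ?mulr_ge0 ?(ltW e_gt0)//.
by rewrite smoothing_scale_sqr// variance1; have := sqr_ge0 e; nra.
Qed.

(** Up to the tail [8 / L ^ 2], the indicator lies between the smoothed ones at [a - L * s] and
    [a + L * s]. Returning from there to [gcdf a] costs [16 * (L * s)], with [s <= 2 * e]. *)
Lemma kolmogorov_bound (L a : R) (I : T -> R) : 0 < L -> mdom E I ->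
  (forall x, I x = (psum N x <= a)%R%:R) ->
  `|mean E I - gcdf a| <= N%:R * (1568 * (m ^+ 2 * b / e ^+ 3))
     + 64 * e ^+ 2 + 32 * (L * e) + 8 / L ^+ 2.
Proof.
move=> L0 dI IE; set s := smoothing_scale N; have LG := lindeberg_gcdf;
  set D := _ + 64 * _ in LG *; clearbody D.
have s0 : 0 < s by rewrite (lt_le_trans e_gt0)// smoothing_scale_ge.
have Ls : 16 * (L * s) <= 32 * (L * e).
  have : L * s <= L * (2 * e) by rewrite ler_pM2l// smoothing_scaleN.
  by move: (L * s) => ?; lra.
have t0 : 0 <= 8 / L ^+ 2 by rewrite divr_ge0// exprn_ge0// ltW.
have up : mean E I <= mean E (fun x => gtest (a + L * s) s (psum N x)) + 8 / L
  ^+ 2.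
  rewrite -(mean_cst E (8 / L ^+ 2)) -meanD//; last exact: mdom_cst.
  apply: mean_le => //; first by apply: mdomD => //; exact: mdom_cst.
  move=> x; rewrite IE; case: (leP (psum N x) a) => xa;
    rewrite ?mulr1n ?mulr0n; last by rewrite addr_ge0// gcdf_ge0.
  rewrite -lerBlDr; apply: le_trans (_ : gcdf L <= _).
    by have := gcdf_tail L0; lra.
  by apply: gcdf_ndecr; rewrite ler_pdivlMr//; lra.
have lo : mean E (fun x => gtest (a - L * s) s (psum N x)) <=
  mean E I + 8 / L ^+ 2.
  rewrite -(mean_cst E (8 / L ^+ 2)) -meanD//; last exact: mdom_cst.
  apply: mean_le => //; first by apply: mdomD => //; exact: mdom_cst.
  move=> x; rewrite IE; case: (leP (psum N x) a) => xa;
    rewrite ?mulr1n ?mulr0n; first by rewrite (le_trans (gcdf_le1 _))// lerDl.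
  rewrite add0r; apply: le_trans (gcdf_tailN L0).
  by apply: gcdf_ndecr; rewrite ler_pdivrMr//; lra.
have l0 : 0 <= L * s by rewrite mulr_ge0// ltW.
have := LG (a + L * s); have := LG (a - L * s).
have := gcdf_lip a (a + L * s); have := gcdf_lip a (a - L * s).
rewrite -/s addrAC subrr add0r normrN (ger0_norm l0) addrAC subrr add0r
  (ger0_norm l0).
move: up lo Ls; move: (gcdf _) (gcdf _) (gcdf _) (mean E _) (mean E _) (mean E
  _).
move: (L * s) (L * e) (8 / _) => {}l le t A B F P Q J up lo Ls.
rewrite !ler_norml => /andP[? ?] /andP[? ?] /andP[? ?] /andP[? ?].
by apply/andP; split; lra.
Qed.

End lindeberg.

(** * Integration of bounded measurable functions *)

Section bounded_mean.
Context {R : realType} d (T : measurableType d) (P : probability T R).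

Definition bounded_measurable (f : T -> R) :=
  measurable_fun setT f /\ exists K, forall x, `|f x| <= K.

Lemma bounded_measurable_integrable f : bounded_measurable f ->
  P.-integrable setT (EFin \o f).
Proof.
move=> [mf [K fK]]; apply: measurable_bounded_integrable => //.
  by have := probability_setT P; move=> /= ->; rewrite ltry.
by exists K; split; [exact: num_real|move=> x Kx y _ /=;
  apply: le_trans (fK y) _; exact: ltW].
Qed.

(** Composition with a continuous [h] stays in the domain because [h] is bounded on a compact
    interval containing the values of [f]. The definition is transparent so that [mean] computes to
    the integral. *)
Definition bounded_mean : mean_operator R T.
Proof.
apply: (@MeanOperator R T bounded_measurable (fun f => \int[P]_x f x)).
- by move=> c; split; [exact: measurable_cst|exists `|c|].
- move=> f g [mf [K fK]] [mg [K' gK]]; split; first exact: measurable_funD.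
  by exists (K + K') => x; apply: le_trans (ler_normD _ _) _; exact: lerD.
- move=> f g [mf [K fK]] [mg [K' gK]]; split; first exact: measurable_funM.
  by exists (K * K') => x; rewrite normrM ler_pM.
- move=> h f ch [mf [K fK]]; split.
    by apply: (measurableT_comp (f := h)) => //;
      exact: continuous_measurable_fun.
  have cK : {within `[- `|K|, `|K|], continuous (fun x => `|h x|)}.
    by apply: continuous_subspaceT => x; apply: cvg_norm; exact: ch.
  have NK : - `|K| <= `|K| by rewrite (@le_trans _ _ 0)// oppr_le0.
  have [c _ hc] := EVT_max NK cK.
  exists `|h c| => x; apply: hc; rewrite in_itv/= -ler_norml.
  by rewrite (le_trans (fK x))// ler_norm.
- by move=> c; rewrite Rintegral_cst//; have := probability_setT P;
  move=> /= ->; rewrite mulr1.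
- by move=> f g df dg; rewrite RintegralD//; exact:
  bounded_measurable_integrable.
- by move=> c f df; rewrite RintegralZl//; exact: bounded_measurable_integrable.
- move=> f g df dg fg; apply: le_Rintegral => //;
  exact: bounded_measurable_integrable.
Defined.

End bounded_mean.

(** * Functions of bounded variation on the circle *)

Section circle_functions.
Context {R : realType}.
Implicit Types (f h psi : R -> R) (x y L : R).

Let frac x := x - (Num.floor x)%:~R.

Lemma periodic_frac f x : periodic f 1 -> f x = f (frac x).
Proof.
move=> pf; have pn n y : f (y + n%:R) = f y by rewrite -(periodicn pf n y).
rewrite /frac; case: (Num.floor x) => n; first by rewrite -[in LHS](subrK
  (n%:R) x) pn.
by rewrite NegzE mulrNz opprK pn.
Qed.

Lemma frac_ge0 x : 0 <= frac x.
Proof. by rewrite subr_ge0 floor_le. Qed.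

Lemma frac_lt1 x : frac x < 1.
Proof. by rewrite ltrBlDl -(intrD _ _ 1) floorD1_gt. Qed.

Lemma measurable_frac : measurable_fun setT frac.
Proof.
apply: measurable_funB; first exact: measurable_id.
apply: nondecreasing_measurable => //.
by move=> x y xy; rewrite ler_int; exact: le_floor.
Qed.

(** Jordan decomposition on [[0, 1]]: [clamp] extends the two monotone parts to monotone functions
    on the line, and [frac] restores periodicity. *)
Lemma circle_bv_measurable f : circle_bv f -> measurable_fun setT f.
Proof.
move=> [pf bf]; pose clamp x := Num.max 0 (Num.min 1 x) : R.
have clampE x : clamp x \in `[0, 1].
  by rewrite in_itv/= le_max lexx/= ge_max ler01/= ge_min lexx.
have clamp_le x y : x <= y -> clamp x <= clamp y.
  by move=> xy; rewrite le_max2// le_min2.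
have -> : f = (fun x => (fine (pos_tv 0 f (clamp (frac x)))
    - fine (neg_tv 0 f (clamp (frac x))))).
  apply/funext => x; rewrite (periodic_frac x pf).
  have E : clamp (frac x) = frac x.
    by rewrite /clamp min_r ?(ltW (frac_lt1 _))// max_r// frac_ge0.
  by rewrite -[in LHS]E (bounded_variation_pos_neg_tvE bf (clampE _)) E.
apply: (measurableT_comp (f := fun y => fine (pos_tv 0 f (clamp y))
  - fine (neg_tv 0 f (clamp y)))); last exact: measurable_frac.
apply: measurable_funB;
    apply: nondecreasing_measurable => // x y xy.
  by apply: (fine_neg_tv_nondecreasing (bounded_variationN bf)) => //;
    exact: clamp_le.
by apply: (fine_neg_tv_nondecreasing bf) => //; exact: clamp_le.
Qed.

Lemma circle_var_ge0 f : 0 <= circle_var f.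
Proof. by apply: fine_ge0; apply: total_variation_ge0; exact: ler01. Qed.

Lemma variation_le_circle_var f s : bounded_variation 0 1 f ->
  itv_partition 0 1 s -> variation 0 1 f s <= circle_var f.
Proof.
move=> bf ps; rewrite /circle_var -lee_fin fineK.
  by apply: ereal_sup_ubound; exists (variation 0 1 f s) => //; exists s.
by apply/bounded_variationP => //; exact: ler01.
Qed.

Lemma circle_bv_bounded f : circle_bv f -> exists K, forall x, `|f x| <= K.
Proof.
move=> [pf bf]; exists (`|f 0| + circle_var f) => x.
rewrite (periodic_frac x pf); set y := frac x.
rewrite -(subrK (f 0) (f y)) addrC; apply: le_trans (ler_normD _ _) _.
rewrite lerD2l.
(* Partitions are strictly increasing, so the one through [y] requires [y != 0]. *)
have [y0|y0] := eqVneq y 0; first by rewrite y0 subrr normr0 circle_var_ge0.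
have ps : itv_partition 0 1 [:: y; 1].
  by split => //=; rewrite !lt_neqAle eq_sym y0 frac_ge0/= -lt_neqAle frac_lt1.
apply: le_trans (variation_le_circle_var bf ps).
by rewrite /variation !big_nat_recl//= big_nil addr0 lerDl.
Qed.

Lemma circle_bv_bounded_measurable f : circle_bv f -> bounded_measurable f.
Proof.
by move=> bf; split; [exact: circle_bv_measurable|exact: circle_bv_bounded].
Qed.

(** Domination of increments passes to the variation along each partition, hence to the supremum,
    which yields finiteness together with the bound. *)
Lemma circle_bv_dominated (r : seq nat) (F : nat -> R -> R) h L :
  0 <= L -> periodic h 1 -> (forall i, i \in r -> circle_bv (F i)) ->
  (forall x y, `|h y - h x| <= L * \sum_(i <- r) `|F i y - F i x|) ->
  circle_bv h /\ circle_var h <= L * \sum_(i <- r) circle_var (F i).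
Proof.
move=> L0 ph bF hF; set V := L * _.
have hV s : itv_partition 0 1 s -> variation 0 1 h s <= V.
  move=> ps; apply: le_trans (_ : L * \sum_(i <- r) variation 0 1 (F i) s <= _).
    rewrite /variation exchange_big big_distrr/=.
    by apply: ler_sum => n _; exact: hF.
  rewrite ler_wpM2l// big_seq [leRHS]big_seq; apply: ler_sum => i /bF[_ bi].
  exact: variation_le_circle_var.
have bh : bounded_variation 0 1 h by exists V => _ [s ps <-]; exact: hV.
split=> //; rewrite /circle_var -lee_fin fineK.
  by apply: ge_ereal_sup => _ [_ [s ps <-] <-]; rewrite lee_fin hV.
by apply/bounded_variationP => //; exact: ler01.
Qed.

End circle_functions.

(** * The rescaled summands and their decorrelation *)

Section circle_sums.
Context {R : realType}.
Variables (C rho theta : R) (N M : nat) (q : nat -> nat) (f : nat -> R -> R).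
Variables (u : nat -> R) (B b : R).
Hypothesis C_gt0 : 0 < C.
Hypothesis rho_gt0 : 0 < rho.
Hypothesis rho_lt1 : rho < 1.
Hypothesis M_gt0 : (0 < M)%N.
Hypothesis B_gt0 : 0 < B.
Hypothesis b_gt0 : 0 < b.
Hypothesis b_le1 : b <= 1.
Hypothesis q_incr : forall k m, (1 <= k)%N -> (k < m)%N -> (m <= N)%N ->
  (q k < q m)%N.
Hypothesis q_ratio : forall k m, (1 <= k)%N -> (k < m)%N -> (m <= N)%N ->
  (q k)%:R / (q m)%:R <= C * rho ^+ (m - k).
Hypothesis f_bv : forall k, (1 <= k <= N)%N -> circle_bv (f k).
Hypothesis f_bound : forall k, (1 <= k <= N)%N ->
  (Linfnorm (f k) <= (u k)%:E)%E.
Hypothesis f_var : forall k, (1 <= k <= N)%N ->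
  circle_var (f k) <= C * u k * (q k)%:R.
Hypothesis u_le : forall k, (1 <= k <= N)%N -> u k / B <= b.
Hypothesis dec_f1 : forall k, (1 <= k <= N)%N ->
  forall psi : R -> R, circle_bv psi ->
  `|circle_int (fun x => psi x * f k x)|
    <= C * circle_var psi * u k * (k%:R `^ theta / (q k)%:R).
Hypothesis dec_f2 : forall k m, (1 <= k)%N -> (k <= m)%N -> (m <= N)%N ->
  forall psi : R -> R, circle_bv psi -> centered psi ->
  `|circle_int (fun x => psi x * f k x * f m x)|
    <= C * circle_var psi * u k * u m * (m%:R `^ theta / (q k)%:R).

Let P : probability (measurableTypeR R) R := circle_measure.
Let E := bounded_mean P.

Lemma u_ge0 k : (1 <= k <= N)%N -> 0 <= u k.
Proof. by move=> kN; rewrite -lee_fin (le_trans _ (f_bound kN))//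
  Lnorm_ge0. Qed.

Lemma circle_ae_bound k : (1 <= k <= N)%N -> {ae P, forall x, `|f k x| <= u k}.
Proof.
move=> kN; have := f_bound kN; rewrite /Linfnorm Lnorm.unlock.
case: ifP => [_ /ess_supP|/negP[]]; last first.
  by have := probability_setT P; move=> /= ->; rewrite lte01.
move=> [A [mA A0 sA]]; exists A; split=> //; apply: subset_trans sA.
Qed.

(* Off a null set, [rescaled k] is [f k / B]; clipping makes the essential
   bound hold everywhere. *)
Definition rescaled (k : nat) (x : R) : R :=
  if (1 <= k <= N)%N then Num.max (- b) (Num.min b (f k x / B)) else 0.

Lemma rescaled_bound k x : `|rescaled k x| <= b.
Proof.
rewrite /rescaled; case: ifP => _; last by rewrite normr0 ltW.
rewrite ler_norml le_max lexx/= ge_max ge_min lexx/= andbT.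
by rewrite (@le_trans _ _ 0)// ?oppr_le0 ltW.
Qed.

Lemma rescaled_measurable k : measurable_fun setT (rescaled k).
Proof.
case kN : (1 <= k <= N)%N; last first.
  have -> : rescaled k = cst 0 by apply/funext => x; rewrite /rescaled kN.
  exact: measurable_cst.
have -> : rescaled k = fun x => Num.max (- b) (Num.min b (f k x / B)).
  by apply/funext => x; rewrite /rescaled kN.
apply: measurable_maxr; first exact: measurable_cst.
apply: measurable_minr; first exact: measurable_cst.
apply: measurable_funM; last exact: measurable_cst.
by apply: circle_bv_measurable; exact: f_bv.
Qed.

Lemma rescaled_dom k : mdom E (rescaled k).
Proof.
by split; [exact: rescaled_measurable|exists b => x; exact: rescaled_bound].
Qed.

(** At these points clipping changes nothing. They have full measure, so integrals may be computed
    with the clipped or the original functions. *)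
Definition regular_point (x : R) :=
  forall k, (1 <= k <= N)%N -> rescaled k x = f k x / B.

Lemma regular_point_ae : {ae P, forall x, regular_point x}.
Proof.
apply/ae_foralln => k.
case kN : (1 <= k <= N)%N; last by apply: aeW.
have := circle_ae_bound kN; apply: filterS => [|x fu _].
  exact: (ae_filter_ringOfSetsType P).
rewrite /rescaled kN.
have : `|f k x / B| <= b.
  rewrite normrM normfV (gtr0_norm B_gt0) (le_trans _ (u_le kN))//.
  by rewrite ler_wpM2r// invr_ge0 ltW.
by rewrite ler_norml => /andP[h1 h2]; rewrite min_r// max_r.
Qed.

Lemma regular_circle_int F G : measurable_fun setT F -> measurable_fun setT G ->
  (forall x, regular_point x -> F x = G x) -> circle_int F = circle_int G.
Proof.
move=> mF mG FG; rewrite /circle_int /Rintegral; congr fine.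
apply: ae_eq_integral => //; [exact/measurable_EFinP|exact/measurable_EFinP|].
have := regular_point_ae; apply: filterS => [|x /FG /= -> //].
exact: (ae_filter_ringOfSetsType P).
Qed.

Lemma regular_psum x j : regular_point x -> (j <= N)%N ->
  psum rescaled j x = partial_sum f j x / B.
Proof.
move=> rx jN; rewrite /psum /partial_sum big_distrl/= !big_nat.
by apply: eq_bigr => k /andP[k1 kj]; rewrite rx// k1 -ltnS (leq_trans kj).
Qed.

(** The value at [0] expresses that the empty sum is constant, without any convention on [q 0]. *)
Let Q (j : nat) : R := if j is 0%N then 0 else (q j)%:R.

(** Each of the at most [N] summands has variation at most [C * (b * B) * q j], and [g (_ / B)]
    multiplies by [L / B]. The shift [c] serves to center the function. *)
Lemma smooth_sum_bv g L j (c : R) : 0 <= L -> lipschitz_with L g ->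
  (j <= N)%N ->
  circle_bv (fun x => g (partial_sum f j x / B) - c)
  /\ circle_var (fun x => g (partial_sum f j x / B) - c)
       <= L * (N%:R * (C * b * Q j)).
Proof.
move=> L0 gL jN.
have bf i : i \in index_iota 1 j.+1 -> circle_bv (f i).
  by rewrite mem_index_iota => /andP[i1 ij]; apply: f_bv;
    rewrite i1 -ltnS (leq_trans ij).
have ps : periodic (fun x => g (partial_sum f j x / B) - c) 1.
  move=> x; congr (g (_ / B) - c); rewrite /partial_sum !big_seq.
  by apply: eq_bigr => i /bf[].
have LB : 0 <= L / B by rewrite divr_ge0// ltW.
have [] := circle_bv_dominated LB ps bf.
  move=> x y /=; rewrite opprD addrACA subrr addr0.
  apply: le_trans (gL _ _) _; rewrite -mulrBl normrM normfV (gtr0_norm B_gt0).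
  rewrite mulrA mulrAC ler_wpM2l// /partial_sum -sumrB.
  exact: ler_norm_sum.
move=> h1 h2; split=> //; apply: le_trans h2 _.
rewrite -[leLHS]mulrA ler_wpM2l// ler_pdivrMl//.
case: j jN bf ps h1 => [|j] jN bf ps h1; first by rewrite big_geq// /Q !mulr0.
apply: le_trans (_ : \sum_(1 <= i < j.+2) (C * (b * B) * (q j.+1)%:R) <= _).
  rewrite !big_nat; apply: ler_sum => i /andP[i1 ij].
  have iN : (1 <= i <= N)%N by rewrite i1 -ltnS (leq_trans ij).
  apply: le_trans (f_var iN) _; rewrite ler_pM ?mulr_ge0 ?(ltW C_gt0) ?u_ge0//.
    by rewrite ler_wpM2l ?(ltW C_gt0)// -ler_pdivrMr// u_le.
  rewrite ler_nat; move: ij; rewrite ltnS leq_eqVlt => /predU1P[->//|ij].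
  by apply: ltnW; exact: q_incr.
rewrite sumr_const_nat subn1/= -[leLHS]mulr_natl.
rewrite (_ : B * _ = N%:R * (C * (b * B) * (q j.+1)%:R)); last by rewrite /Q;
  ring.
by rewrite ler_wpM2r ?ler_nat// !mulr_ge0// ltW.
Qed.

Lemma Q_ratio j k : (1 <= k)%N -> (k <= N)%N -> (j <= k - M)%N ->
  Q j / (q k)%:R <= C * rho ^+ M.
Proof.
have C0 := ltW C_gt0; have r0 := ltW rho_gt0.
case: j => [|j] k1 kN jk; first by rewrite mul0r mulr_ge0// exprn_ge0.
apply: le_trans (q_ratio _ _ kN) _ => //; first by lia.
by rewrite ler_wpM2l// ler_wiXn2l ?(ltW rho_lt1)//; lia.
Qed.

Lemma powR_index_le k : (1 <= k)%N -> (k <= N)%N ->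
  k%:R `^ theta <= N%:R `^ `|theta| :> R.
Proof.
move=> k1 kN; apply: le_trans (_ : k%:R `^ `|theta| <= _).
  by rewrite ler_powR ?ler1n// ler_norm.
by rewrite ge0_ler_powR ?nnegrE// ler_nat.
Qed.

Definition decorrelation_rate : R :=
  C ^+ 3 * (N%:R * N%:R `^ `|theta|) * b ^+ 2 * rho ^+ M.

Lemma decorrelation_rate_ge0 : 0 <= decorrelation_rate.
Proof.
by rewrite /decorrelation_rate !mulr_ge0 ?exprn_ge0 ?powR_ge0 ?(ltW C_gt0)
  ?(ltW rho_gt0) ?(ltW b_gt0).
Qed.

Lemma lipschitz_const_ge0 L (g : R -> R) : lipschitz_with L g -> 0 <= L.
Proof. by move=> /(_ 0 1); rewrite subr0 normr1 mulr1; apply: le_trans. Qed.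

Let smooth_measurable g L j : lipschitz_with L g -> (j <= N)%N ->
  measurable_fun setT (fun x => g (partial_sum f j x / B)).
Proof.
move=> gL jN; have := (smooth_sum_bv 0 (lipschitz_const_ge0 gL) gL jN).1.
by move/circle_bv_measurable; under eq_fun do rewrite subr0.
Qed.

Let smooth_rescaled_measurable g L j : lipschitz_with L g ->
  measurable_fun setT (fun x => g (psum rescaled j x)).
Proof.
move=> gL; have dp : mdom E (psum rescaled j) by exact: psum_dom rescaled_dom j.
by have [] := mdom_comp (lipschitz_with_continuous gL) dp.
Qed.

Lemma rescaled_decorrelated1 :
  decorrelated1 E N M rescaled decorrelation_rate.
Proof.
move=> g L j k gL k1 kN jk.
have L0 := lipschitz_const_ge0 gL.
have jN : (j <= N)%N by lia.
have kkN : (1 <= k <= N)%N by rewrite k1.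
pose psi x := g (partial_sum f j x / B) - 0.
have [bpsi vpsi] : circle_bv psi /\ circle_var psi <=
  _ := smooth_sum_bv 0 L0 gL jN.
have mf := circle_bv_measurable (f_bv kkN).
have -> : mean E (fun x => g (psum rescaled j x) * rescaled k x) =
    B^-1 * circle_int (fun x => psi x * f k x).
  have bm : mdom E (fun x => psi x * f k x).
    by apply: mdomM; apply: circle_bv_bounded_measurable => //; exact: f_bv.
  rewrite -(meanZ B^-1 bm); apply: regular_circle_int.
  - by apply: measurable_funM; [exact: smooth_rescaled_measurable gL|exact:
    rescaled_measurable].
  - by have [] := mdomZ B^-1 bm.
  - by move=> x rx; rewrite regular_psum// rx// /psi subr0; ring.
rewrite normrM normfV (gtr0_norm B_gt0) mulrC ler_pdivrMr//.
apply: le_trans (dec_f1 kkN bpsi) _.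
have u0 := u_ge0 kkN; have C0 := ltW C_gt0; have b0 := ltW b_gt0.
have uB : u k <= b * B by rewrite -ler_pdivrMr// u_le.
have pw := powR_index_le k1 kN.
have QC := Q_ratio k1 kN jk.
have Q0 : 0 <= Q j by rewrite /Q; case: (j).
have v0 := circle_var_ge0 psi.
apply: le_trans (_ : C * (L * (N%:R * (C * b * Q j))) * (b * B) * (N%:R `^
  `|theta| / (q k)%:R) <= _).
  rewrite ler_pM ?mulr_ge0 ?invr_ge0 ?powR_ge0// ?ler_wpM2r ?invr_ge0//.
  by rewrite ler_pM ?mulr_ge0// ler_wpM2l.
rewrite (_ : _ * (_ / _) = L * B * (C ^+ 2 * (N%:R * N%:R `^ `|theta|) * b ^+
  2) * (Q j / (q k)%:R)); last by ring.
rewrite (_ : L * decorrelation_rate * B = L * B * (C ^+ 2 * (N%:R * N%:R `^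
  `|theta|) * b ^+ 2) * (C * rho ^+ M)).
  by rewrite ler_wpM2l// !mulr_ge0 ?exprn_ge0 ?powR_ge0// ltW.
by rewrite /decorrelation_rate; ring.
Qed.

Lemma rescaled_decorrelated2 :
  decorrelated2 E N M rescaled decorrelation_rate.
Proof.
move=> g L i j k gL j1 jk kN ij.
have L0 := lipschitz_const_ge0 gL.
have iN : (i <= N)%N by lia.
have jjN : (1 <= j <= N)%N by rewrite j1 (leq_trans jk).
have k1 : (1 <= k)%N by exact: leq_trans jk.
have kkN : (1 <= k <= N)%N by rewrite k1.
pose c := mean E (fun x => g (psum rescaled i x)).
pose psi x := g (partial_sum f i x / B) - c.
have [bpsi vpsi] : circle_bv psi /\ circle_var psi <=
  _ := smooth_sum_bv c L0 gL iN.
have dg : mdom E (fun x => g (psum rescaled i x)).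
  by apply: mdom_comp (lipschitz_with_continuous gL) (psum_dom _ _);
    exact: rescaled_dom.
have dXX : mdom E (fun x => rescaled j x * rescaled k x).
  by apply: mdomM; exact: rescaled_dom.
(* [c] is computed from the clipped sum and [psi] from the original one; they agree at regular
   points. *)
have cpsi : centered psi.
  rewrite /centered.
  have -> : circle_int psi = mean E (fun x => g (psum rescaled i x) - c).
    apply: regular_circle_int; first exact: circle_bv_measurable.
      by have [] := mdomB dg (mdom_cst E c).
    by move=> x rx; rewrite regular_psum.
  by rewrite meanB ?mean_cst ?subrr//; exact: mdom_cst.
have bm : mdom E (fun x => psi x * f j x * f k x).
  by do 2?apply: mdomM; apply: circle_bv_bounded_measurable => //; exact: f_bv.
have -> : mean E (fun x => g (psum rescaled i x) * (rescaled j x * rescaled k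
  x))
    - mean E (fun x => g (psum rescaled i x)) * mean E (fun x => rescaled j x *
      rescaled k x)
    = B^-1 ^+ 2 * circle_int (fun x => psi x * f j x * f k x).
  rewrite -/c -(meanZ c dXX) -meanB; [|exact: mdomM|exact: mdomZ].
  rewrite -(meanZ (B^-1 ^+ 2) bm); apply: regular_circle_int.
  - by have [] := mdomB (mdomM dg dXX) (mdomZ c dXX).
  - by have [] := mdomZ (B^-1 ^+ 2) bm.
  - by move=> x rx; rewrite regular_psum// !rx// /psi; ring.
rewrite normrM normrX normfV (gtr0_norm B_gt0) exprVn mulrC ler_pdivrMr
  ?exprn_gt0//.
apply: le_trans (dec_f2 j1 jk kN bpsi cpsi) _.
have uj0 := u_ge0 jjN; have uk0 := u_ge0 kkN; have C0 := ltW C_gt0;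
  have b0 := ltW b_gt0.
have ujB : u j <= b * B by rewrite -ler_pdivrMr// u_le.
have ukB : u k <= b * B by rewrite -ler_pdivrMr// u_le.
have pw := powR_index_le k1 kN.
have QC := Q_ratio j1 (leq_trans jk kN) ij.
have Q0 : 0 <= Q i by rewrite /Q; case: (i).
have v0 := circle_var_ge0 psi.
apply: le_trans (_ : C * (L * (N%:R * (C * b * Q i))) * (b * B) * (b * B) *
  (N%:R `^ `|theta| / (q j)%:R) <= _).
  rewrite ler_pM ?mulr_ge0 ?invr_ge0 ?powR_ge0// ?ler_wpM2r ?invr_ge0//.
  by do 2?rewrite ler_pM ?mulr_ge0//; rewrite ler_wpM2l.
rewrite (_ : _ * (_ / _) = L * B ^+ 2 * (C ^+ 2 * (N%:R * N%:R `^ `|theta|) * b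
  ^+ 2) * (Q i / (q j)%:R) * b); last by ring.
rewrite (_ : L * decorrelation_rate * B ^+ 2 = L * B ^+ 2 * (C ^+ 2 * (N%:R *
  N%:R `^ `|theta|) * b ^+ 2) * (C * rho ^+ M)); last first.
  by rewrite /decorrelation_rate; ring.
set K := L * B ^+ 2 * _.
have K0 : 0 <= K by rewrite !mulr_ge0 ?exprn_ge0 ?powR_ge0// ltW.
(* The second summand brings one more factor [b], dropped since [b <= 1]. *)
apply: le_trans (_ : K * (Q i / (q j)%:R) <= _); last by rewrite ler_wpM2l.
by rewrite ler_piMr// mulr_ge0// divr_ge0.
Qed.

Let S_bounded_measurable : bounded_measurable (T := measurableTypeR R)
  (partial_sum f N).
Proof.
split; last first.
  have [K SK] : exists K, forall x, `|partial_sum f N x| <= K.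
    have [K fK] : exists K : nat -> R, forall k, (1 <= k <= N)%N -> forall x,
      `|f k x| <= K k.
      have fK k : exists K, (1 <= k <= N)%N -> forall x, `|f k x| <= K.
        case kN : (1 <= k <= N)%N; last by exists 0.
        by have [K fK] := circle_bv_bounded (f_bv kN); exists K.
      by have [K HK] := choice fK; exists K.
    exists (\sum_(1 <= k < N.+1) K k) => x; rewrite /partial_sum.
    apply: le_trans (ler_norm_sum _ _ _) _; rewrite !big_nat.
    by apply: ler_sum => k /andP[k1 kN]; apply: fK; rewrite k1 -ltnS.
  by exists K.
have := smooth_measurable (g := fun y => y) (L := 1) (j := N).
have l1 : lipschitz_with 1 (fun y : R => y) by move=> x y; rewrite mul1r.
move=> /(_ l1 (leqnn _)) mSB.
have -> : partial_sum f N = (fun x => B * (partial_sum f N x / B)).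
  by apply/funext => x; rewrite mulrC divfK// gt_eqF.
by apply: measurable_funM => //; exact: measurable_cst.
Qed.

(** [fine] is harmless here: an infinite norm would have an infinite square, yet that square is the
    integral of a bounded function. *)
Lemma L2norm_sqr : circle_int (fun x => partial_sum f N x ^+ 2)
  = L2norm (partial_sum f N) ^+ 2.
Proof.
set S := partial_sum f N.
have bS2 : bounded_measurable (T := measurableTypeR R) (fun x => S x ^+ 2).
  by apply: (mdomX (E := E)); exact: S_bounded_measurable.
have iS := bounded_measurable_integrable P bS2.
have SE : (\int[circle_measure]_x `|(EFin \o S) x| `^ 2 = (circle_int (fun x =>
  S x ^+ 2))%:E)%E.
  rewrite /circle_int /Rintegral fineK; last exact: (integrable_fin_num
    measurableT iS).
  by apply: eq_integral => x _ /=; rewrite powR_mulrn// real_normK ?num_real.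
have := poweR_Lnorm circle_measure (EFin \o S) (r := 2).
rewrite SE pnatr_eq0 => /(_ isT).
rewrite /L2norm; have := Lnorm_ge0 circle_measure 2%:E (EFin \o S).
case: (Lnorm _ _ _) => [r| |] //; last by rewrite poweRyr ?pnatr_eq0.
by rewrite lee_fin => r0 /= [<-]; rewrite powR_mulrn.
Qed.

(** * Normalization and law of the rescaled sum *)

Hypothesis B_def : B = L2norm (partial_sum f N).

Lemma rescaled_variance : mean E (fun x => psum rescaled N x ^+ 2) = 1.
Proof.
have bS2 : mdom E (fun x => partial_sum f N x ^+ 2).
  by apply: mdomX; exact: S_bounded_measurable.
have -> : mean E (fun x => psum rescaled N x ^+ 2) =
    mean E (fun x => B^-1 ^+ 2 * partial_sum f N x ^+ 2).
  apply: regular_circle_int.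
  - by have [] := mdomX 2 (psum_dom rescaled_dom N).
  - by have [] := mdomZ (B^-1 ^+ 2) bS2.
  - by move=> x rx; rewrite regular_psum// exprMn mulrC.
rewrite meanZ//.
have -> : mean E (fun x => partial_sum f N x ^+ 2) = B ^+ 2 by rewrite B_def
  -L2norm_sqr.
by rewrite -exprMn mulVf ?gt_eqF// expr1n.
Qed.

Definition below (a : R) (x : R) : R := (psum rescaled N x <= a)%R%:R.

Lemma below_indic a : below a = \1_[set x | psum rescaled N x <= a].
Proof.
apply/funext => x; rewrite /below indicE; congr (_%:R).
have [h|h] := boolP (psum rescaled N x <= a); first by rewrite mem_set.
by rewrite memNset//; exact/negP.
Qed.

Lemma measurable_below (F : R -> R) a : measurable_fun setT F ->
  measurable [set x | F x <= a].
Proof.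
move=> mF; have := measurable_fun_ler mF (measurable_cst a) => /(_ measurableT
  [set true] I).
by rewrite setTI; congr measurable; apply/seteqP; split => x /=; case: (_ <= _).
Qed.

Lemma below_dom a : mdom E (below a).
Proof.
split; last by exists 1 => x; rewrite /below ger0_norm ?ler0n// lern1 leq_b1.
rewrite below_indic; apply: measurable_indic; apply: measurable_below.
by have [] := psum_dom rescaled_dom N.
Qed.

Lemma prob_below a : fine (circle_measure [set x | partial_sum f N x / B <= a])
  = mean E (below a).
Proof.
have mSB : measurable_fun setT (fun x => partial_sum f N x / B).
  apply: measurable_funM; last exact: measurable_cst.
  by have [] := S_bounded_measurable.
have mA : measurable [set x | partial_sum f N x / B <=
  a] by exact: measurable_below.
transitivity (circle_int (\1_[set x | partial_sum f N x / B <= a])).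
  by rewrite /circle_int /Rintegral integral_indic// setIT.
apply: regular_circle_int.
- exact: measurable_indic.
- by have [] := below_dom a.
- move=> x rx; rewrite below_indic !indicE; congr (_%:R).
  by congr (nat_of_bool _); rewrite /in_mem /= /in_set/= regular_psum.
Qed.

Lemma kolmogorov_dist_le d (Omega : measurableType d) (P' : probability Omega R)
    (Y1 : {RV P' >-> R}) (K : R) : standard_normal Y1 ->
  (forall a, `|mean E (below a) - gcdf a| <= K) ->
  kolmogorov_dist circle_measure P' (fun x => partial_sum f N x / B) Y1 <= K.
Proof.
move=> nY HK; apply: ge_sup; first by exists (`|fine (circle_measure [set x |
  partial_sum f N x / B <= 0]) - fine (P' [set t | Y1 t <= 0])|), 0.
move=> _ [a _ <-]; rewrite prob_below.
have -> : fine (P' [set t | Y1 t <= a]) = gcdf a; last exact: HK.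
rewrite /gcdf -nY//; congr (fine (P' _)).
Qed.

End circle_sums.

(** * The parameters as powers of [N] *)

Section parameters.
Context {R : realType}.

(** For an integer [n > A / c] one has [x ^ A <= M ^ n], and [M ^ n * rho ^ M] is the [n]-th power
    of [M * exp (- l * M / n)], which is at most [n / l] because [y * exp (- y) <= 1]. *)
Lemma power_mul_geometric_bounded (rho A c : R) :
  0 < rho -> rho < 1 -> 0 <= A -> 0 < c ->
  exists K, forall (x : R) (M : nat), 1 <= x -> x `^ c <= M%:R ->
    x `^ A * rho ^+ M <= K.
Proof.
move=> rho0 rho1 A0 c0; pose n := (Num.truncn (A / c)).+1.
pose l := - ln rho; have l0 : 0 < l by rewrite oppr_gt0 ln_lt0// rho0.
have n0 : 0 < n%:R :> R by rewrite ltr0n.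
exists ((n%:R / l) ^+ n) => x M x1 xM.
have x0 : 0 < x by exact: lt_le_trans x1.
have xA : x `^ A <= M%:R ^+ n.
  apply: le_trans (_ : (x `^ c) ^+ n <= _); last first.
    by rewrite lerXn2r ?nnegrE ?powR_ge0.
  rewrite -powR_mulrn ?powR_ge0// -powRrM ler_powR// -ler_pdivrMl// mulrC.
  by rewrite ltW// truncnS_gt.
have rhoM : rho ^+ M = (expR (- (l * M%:R / n%:R))) ^+ n.
  rewrite -expRM_natl (_ : n%:R * _ = M%:R * ln rho).
    by rewrite expRM_natl lnK.
  by rewrite /l; field; rewrite gt_eqF.
apply: le_trans (_ : M%:R ^+ n * rho ^+ M <= _).
  by rewrite ler_wpM2r// exprn_ge0// ltW.
have nl0 : 0 <= n%:R / l by rewrite divr_ge0// ltW.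
have Me0 : 0 <= M%:R * expR (- (l * M%:R / n%:R)) by rewrite mulr_ge0//
  expR_ge0.
rewrite rhoM -exprMn lerXn2r ?nnegrE//.
have y1 : l * M%:R / n%:R <= expR (l * M%:R / n%:R).
  by apply: le_trans (expR_ge1Dx _); rewrite lerDr.
rewrite expRN ler_pdivrMr ?expR_gt0// -ler_pdivrMl ?divr_gt0//.
by rewrite invf_div mulrC mulrA [_ * l]mulrC.
Qed.

Variables (C rho theta p x r b e L : R) (M : nat).
Hypothesis rE : r = (1 - 8 * p) / 12.
Hypothesis bE : b = x `^ (p - 1 / 2).
Hypothesis eE : e = x `^ (- (3 * r / 2)) / 2.
Hypothesis LE : L = x `^ (r / 2).
Hypothesis ME : M = (Num.truncn (x `^ (1 / 48))).+1.
Hypothesis p_ge0 : 0 <= p.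
Hypothesis p_lt : p < 1 / 8.
Hypothesis N_ge : 1 <= x.

Let x_gt0 : 0 < x.
Proof. exact: lt_le_trans N_ge. Qed.

Let xD a a' : x `^ (a + a') = x `^ a * x `^ a'.
Proof. by rewrite powRD// (gt_eqF x_gt0) implybT. Qed.

Let x_ge1 a : 0 <= a -> 1 <= x `^ a.
Proof. by move=> a0; rewrite -[leLHS](powRr0 x) ler_powR. Qed.

Let x_le1 a : a <= 0 -> x `^ a <= 1.
Proof. by move=> a0; rewrite -[leRHS](powRr0 x) ler_powR. Qed.

Let xX a n : (x `^ a) ^+ n = x `^ (a * n%:R).
Proof. by rewrite -powR_mulrn ?powR_ge0// powRrM. Qed.

Let r_gt0 : 0 < r. Proof. by rewrite rE; have := p_ge0; have := p_lt; lra. Qed.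

Let r_le : r <= 1 / 12. Proof. by rewrite rE; have := p_ge0; have := p_lt;
  lra. Qed.

Lemma window_ge : x `^ (1 / 48) <= M%:R.
Proof. by rewrite ME ltW// truncnS_gt. Qed.

Lemma window_le : M%:R <= 2 * x `^ (1 / 48).
Proof.
have x1 : 1 <= x `^ (1 / 48) by apply: x_ge1; rewrite divr_ge0.
rewrite ME -natr1.
have : (Num.truncn (x `^ (1 / 48)))%:R <= x `^ (1 / 48) by rewrite truncn_le//
  powR_ge0.
by lra.
Qed.

Lemma jump_gt0 : 0 < b. Proof. by rewrite bE powR_gt0. Qed.

Lemma jump_le1 : b <= 1.
Proof. by rewrite bE; apply: x_le1; have := p_lt; lra. Qed.

Lemma scale_gt0 : 0 < e. Proof. by rewrite eE divr_gt0// powR_gt0. Qed.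

Lemma scale_le : e <= 2^-1.
Proof.
rewrite eE ler_pdivrMr// mulVf ?pnatr_eq0//; apply: x_le1.
by have := r_gt0; lra.
Qed.

(** As [- 3 * r = 2 * p - 1 / 4], the exponents of [e ^ 2] and [(M * b) ^ 2] differ by
    [3 / 4 - 1 / 24 = 17 / 24], and [160 = 10 * 2 ^ 2 * 2 ^ 2]. *)
Lemma window_small_of_large : 160 <= x `^ (17 / 24) ->
  10 * (M%:R * b) ^+ 2 <= e ^+ 2.
Proof.
move=> x160; have b0 := ltW jump_gt0.
apply: le_trans (_ : 10 * (2 * x `^ (1 / 48) * b) ^+ 2 <= _).
  rewrite ler_wpM2l// lerXn2r ?nnegrE ?mulr_ge0 ?powR_ge0//.
  by rewrite ler_wpM2r// window_le.
rewrite eE bE !exprMn !xX.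
have -> : x `^ (- (3 * r / 2) * 2%:R) = x `^ (1 / 48 * 2%:R) * x `^ ((p - 1 /
  2) * 2%:R) * x `^ (17 / 24).
  by rewrite -!xD; congr (_ `^ _); rewrite rE; field.
have y0 : 0 <= x `^ (1 / 48 * 2%:R) * x `^ ((p - 1 / 2) * 2%:R) by rewrite
  mulr_ge0 ?powR_ge0.
rewrite (_ : 10 * _ = 40 * (x `^ (1 / 48 * 2%:R) * x `^ ((p - 1 / 2) * 2%:R)));
  last by ring.
move: y0; set y := x `^ _ * x `^ _ => y0.
rewrite (_ : 2^-1 ^+ 2 = 4^-1 :> R); last by field.
by have := ler_wpM2l y0 x160; move: (y * _) => *; lra.
Qed.

(** Since [b >= x ^ (- 1 / 2)], it suffices that [C ^ 3 * x ^ (5 / 2 + |theta|) * rho ^ M <= 1]. One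
    further power of [x] turns this into a bounded quantity compared with [x]. *)
Lemma rate_small_of_large : 0 < C -> 0 < rho ->
  C ^+ 3 * (x `^ (7 / 2 + `|theta|) * rho ^+ M) <= x ->
  x * (C ^+ 3 * (x * x `^ `|theta|) * b ^+ 2 * rho ^+ M) <= b ^+ 3.
Proof.
move=> C0 rho0 H; have b0 := jump_gt0.
move: (rho ^+ M) H => g H.
rewrite (_ : x * _ = b ^+ 2 * (C ^+ 3 * (x * x * x `^ `|theta| * g)));
  last by ring.
rewrite [leRHS]exprSr ler_wpM2l ?sqr_ge0//.
apply: le_trans (_ : x `^ (- (1 / 2)) <= _); last by rewrite bE ler_powR//;
  have := p_ge0; lra.
have xE : x * x * x `^ `|theta| = x `^ (7 / 2 + `|theta|) * x `^ (- (3 / 2)).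
  rewrite -[X in X * X * _](powRr1 (ltW x_gt0)) -!xD.
  by congr (_ `^ _); field.
rewrite xE (_ : C ^+ 3 * _ = C ^+ 3 * (x `^ (7 / 2 + `|theta|) * g) * x `^ (-
  (3 / 2))); last by ring.
have -> : x `^ (- (1 / 2)) = x * x `^ (- (3 / 2)).
  by rewrite -{2}(powRr1 (ltW x_gt0)) -!xD; congr (_ `^ _); field.
by rewrite ler_wpM2r ?powR_ge0.
Qed.

Lemma total_error_le (c : R) : 0 <= c ->
  x * (c * ((M%:R * b) ^+ 2 * b / e ^+ 3)) + 64 * e ^+ 2 + 32 * (L * e) + 8 / L
    ^+ 2
  <= (c * 32 + 40) * x `^ (- r).
Proof.
move=> c0; have b0 := ltW jump_gt0; have e0 := scale_gt0.
have T1 : x * ((M%:R * b) ^+ 2 * b / e ^+ 3) <= 32 * x `^ (- r).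
  apply: le_trans (_ : x * ((2 * x `^ (1 / 48) * b) ^+ 2 * b / e ^+ 3) <= _).
    rewrite ler_wpM2l ?(ltW x_gt0)// ler_wpM2r ?invr_ge0 ?exprn_ge0 ?(ltW e0)//.
    rewrite ler_wpM2r// lerXn2r ?nnegrE ?mulr_ge0 ?powR_ge0//.
    by rewrite ler_wpM2r// window_le.
  have eV : (e ^+ 3)^-1 = 8 * x `^ (9 * r / 2).
    rewrite eE exprMn xX invfM -powRN mulrC; congr (_ * _ `^ _); last by field.
    by field.
  rewrite eV bE !exprMn !xX -[X in X * _ <= _](powRr1 (ltW x_gt0)).
  rewrite [leLHS](_ : _ = 32 * (x `^ 1 * x `^ (1 / 48 * 2%:R) * x `^ ((p - 1 /
    2) * 2%:R) * x `^ (p - 1 / 2) * x `^ (9 * r / 2))); last by ring.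
  rewrite ler_wpM2l// -!xD ler_powR//.
  (* The exponents add up to [1 / 24 - 1 / 8 = - 1 / 12], which is at most [- r]. *)
  by have := r_le; have := rE; lra.
have T2 : e ^+ 2 <= x `^ (- r) / 4.
  rewrite eE exprMn xX (_ : 2^-1 ^+ 2 = 4^-1); last by field.
  by rewrite ler_wpM2r// ler_powR//; have := r_gt0; lra.
have T3 : L * e = x `^ (- r) / 2.
  by rewrite eE LE mulrA -xD; congr (_ `^ _ / _); field.
have T4 : 8 / L ^+ 2 = 8 * x `^ (- r).
  by rewrite LE xX -powRN; congr (_ * _ `^ _); field.
rewrite T3 T4 mulrCA.
have := ler_wpM2l c0 T1; move: T2.
by move: (x * _) (x `^ (- r)) (e ^+ 2) => t y z; lra.
Qed.

End parameters.

(** * Conclusion, with small [N] treated apart *)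

Theorem proposition2p1 (R : realType) (C rho theta : R)
    (C_gt0 : 0 < C) (rho_gt0 : 0 < rho) (rho_lt1 : rho < 1) :
  forall delta : R, 0 < delta ->
  exists2 Cdelta : R, 0 < Cdelta &
  forall (N : nat) (q : nat -> nat) (f : nat -> R -> R) (u : nat -> R) (p : R)
    (d : measure_display) (Omega : measurableType d) (P : probability Omega R)
    (Y1 : {RV P >-> R}),
  (0 < N)%N ->
  (forall k, (1 <= k <= N)%N -> (0 < q k)%N) ->
  (forall k m, (1 <= k)%N -> (k < m)%N -> (m <= N)%N -> (q k < q m)%N) ->
  (forall k m, (1 <= k)%N -> (k < m)%N -> (m <= N)%N ->
    (q k)%:R / (q m)%:R <= C * rho ^+ (m - k)) ->
  (forall k, (1 <= k <= N)%N -> circle_bv (f k) /\ centered (f k)) ->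
  (forall k, (1 <= k <= N)%N -> (Linfnorm (f k) <= (u k)%:E)%E) ->
  (forall k, (1 <= k <= N)%N -> circle_var (f k) <= C * u k * (q k)%:R) ->
  (forall k, (1 <= k <= N)%N ->
    forall psi : R -> R, circle_bv psi ->
    `|circle_int (fun x => psi x * f k x)|
      <= C * circle_var psi * u k * (k%:R `^ theta / (q k)%:R)) ->
  (forall k m, (1 <= k)%N -> (k <= m)%N -> (m <= N)%N ->
    forall psi : R -> R, circle_bv psi -> centered psi ->
    `|circle_int (fun x => psi x * f k x * f m x)|
      <= C * circle_var psi * u k * u m * (m%:R `^ theta / (q k)%:R)) ->
  (forall k m t, (1 <= k)%N -> (k <= m)%N -> (m <= t)%N -> (t <= N)%N ->
    forall psi : R -> R, circle_bv psi -> centered psi ->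
    `|circle_int (fun x => psi x * f k x * f m x * f t x)|
      <= C * circle_var psi * u k * u m * u t * (t%:R `^ theta / (q k)%:R)) ->
  0 < L2norm (partial_sum f N) ->
  0 <= p -> p < 1 / 8 ->
  max_upto u N / L2norm (partial_sum f N) <= N%:R `^ (p - 1 / 2) ->
  standard_normal Y1 ->
  kolmogorov_dist circle_measure P
      (fun x => partial_sum f N x / L2norm (partial_sum f N)) Y1
    <= Cdelta * N%:R `^ (- ((1 - 8 * p) / 12) + delta).
Proof.
move=> delta delta_gt0.
have A0 : 0 <= 7 / 2 + `|theta| by rewrite addr_ge0// divr_ge0.
have c48 : 0 < 1 / 48 :> R by rewrite divr_gt0.
have [K HK] := power_mul_geometric_bounded rho_gt0 rho_lt1 A0 c48.
(* Beyond this threshold both smallness conditions hold: [N ^ (17 / 24) >= N ^ (1 / 2) >= 160], and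
   [C ^ 3 * K <= N] for the decorrelation rate. *)
pose T := Num.max (160 ^+ 2) (C ^+ 3 * K).
(* The factor in [total_error_le] at [c = 1568], the constant of one step. *)
have [K0 K0_ge0 K0E] : exists2 K0 : R, 0 <= K0 & 1568 * 32 + 40 = K0.
  exists (1568 * 32 + 40); last by [].
  exact: addr_ge0 (mulr_ge0 (ler0n _ _) (ler0n _ _)) (ler0n _ _).
have T_gt0 : 0 < T by rewrite lt_max exprn_gt0// ltr0n.
exists (K0 + T); first by rewrite ltr_wpDl.
move=> N q f u p d Omega P Y1 N_gt0 q_gt0 q_incr q_ratio f_circle f_bound f_var.
move=> dec_f1 dec_f2 _ B_gt0 p_ge0 p_lt w_le Y1_normal.
set x : R := N%:R; have x_ge1 : 1 <= x by rewrite ler1n.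
set B := L2norm _; set r := (1 - 8 * p) / 12.
have r_gt0 : 0 < r by rewrite /r; move: p_lt; clear; lra.
have r_le1 : r <= 1 by rewrite /r; move: p_ge0; clear; lra.
suff main : kolmogorov_dist circle_measure P (fun t => partial_sum f N t / B) Y1
    <= (K0 + T) * x `^ (- r).
  apply: le_trans main _; rewrite ler_wpM2l ?addr_ge0 ?(ltW T_gt0)//.
  by rewrite ler_powR// lerDl ltW.
set b := x `^ (p - 1 / 2); set e := x `^ (- (3 * r / 2)) / 2.
set L := x `^ (r / 2); pose M := (Num.truncn (x `^ (1 / 48))).+1.
have b_gt0 : 0 < b by exact: powR_gt0 (lt_le_trans ltr01 x_ge1).
have f_bv k : (1 <= k <= N)%N -> circle_bv (f k) by move=> /f_circle[].
have u_le k : (1 <= k <= N)%N -> u k / B <= b.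
  move=> /andP[k1 kN]; apply: le_trans w_le.
  rewrite ler_wpM2r ?invr_ge0 ?(ltW B_gt0)//.
  by apply: le_bigmax_seq => //; rewrite mem_index_iota k1 ltnS.
have below_mean a := below_dom B b_gt0 f_bv a.
apply: (kolmogorov_dist_le C_gt0 B_gt0 b_gt0 q_incr f_bv f_bound f_var u_le
  Y1_normal).
(* Below the threshold the bound is trivial: the difference is at most [1], and [N ^ r <= N < T]
   because [r <= 1]. *)
move=> a; have [Tx|xT] := leP T x; last first.
  apply: le_trans (_ : 1 <= _).
    have m0 : 0 <= mean (bounded_mean circle_measure) (below N f B b a).
      by apply: mean_ge0 => // t; exact: ler0n.
    have m1 : `|mean (bounded_mean circle_measure) (below N f B b a)| <= 1.
      by apply: mean_norm_le => // t; rewrite ger0_norm ?ler0n// lern1 leq_b1.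
    move: m0 m1 (gcdf_ge0 a) (gcdf_le1 a); move: (mean _ _) (gcdf a) => y z.
    by clear; rewrite !ler_norml => ? /andP[? ?] ? ?; apply/andP; split; lra.
  rewrite powRN -ler_pdivrMr ?invr_gt0 ?powR_gt0 ?(lt_le_trans ltr01)//.
  rewrite invrK mul1r; apply: le_trans (_ : x <= _).
    by rewrite -[leRHS]powRr1 ?ler_powR// ltW// (lt_le_trans ltr01).
  by rewrite (le_trans (ltW xT))// lerDr.
have rate_ge0 := decorrelation_rate_ge0 theta N M C_gt0 rho_gt0 b_gt0.
have M_gt0 : (0 < M)%N by [].
have b_le1 : b <= 1 := jump_le1 erefl p_lt x_ge1.
have dec1 := rescaled_decorrelated1 C_gt0 rho_gt0 rho_lt1 M_gt0 B_gt0 b_gt0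
  b_le1 q_incr q_ratio f_bv f_bound f_var u_le dec_f1.
have dec2 := rescaled_decorrelated2 C_gt0 rho_gt0 rho_lt1 M_gt0 B_gt0 b_gt0
  b_le1 q_incr q_ratio f_bv f_bound f_var u_le dec_f2.
have var1 := rescaled_variance C_gt0 B_gt0 b_gt0 q_incr f_bv f_bound f_var u_le
  erefl.
have e_gt0 : 0 < e by rewrite divr_gt0// powR_gt0// (lt_le_trans ltr01).
have e_le : e <= 2^-1 := scale_le erefl erefl p_ge0 p_lt x_ge1.
have L_gt0 : 0 < L by rewrite powR_gt0// (lt_le_trans ltr01).
have small : 10 * (M%:R * b) ^+ 2 <= e ^+ 2.
  apply: (@window_small_of_large _ p x r b e M) => //.
  apply: le_trans (_ : x `^ (1 / 2) <= _); last first.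
    by rewrite ler_powR//; clear; lra.
  rewrite -(@ler_pXn2r _ 2) ?nnegrE ?powR_ge0//.
  rewrite -[leRHS]powR_mulrn ?powR_ge0// -powRrM divfK ?pnatr_eq0//
    powRr1 ?ler0n//.
  by apply: le_trans Tx; rewrite le_max lexx.
have rate_small : N%:R * decorrelation_rate C rho theta N M b <= b ^+ 3.
  apply: (@rate_small_of_large _ _ _ _ p x b M erefl p_ge0 x_ge1 C_gt0 rho_gt0).
  apply: le_trans Tx; rewrite le_max; apply/orP; right.
  rewrite ler_wpM2l ?exprn_ge0 ?(ltW C_gt0)//.
  by apply: HK => //; exact: window_ge erefl.
apply: le_trans (kolmogorov_bound M_gt0 (ltW b_gt0) rate_ge0
  (rescaled_dom B b_gt0 f_bv) (rescaled_bound N f B b_gt0) dec1 dec2 N_gt0 e_gt0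
  e_le small rate_small var1 L_gt0 (below_mean a) (fun t => erefl)) _.
have := @total_error_le _ p x r b e L M erefl erefl erefl erefl erefl p_ge0 p_lt
  x_ge1 1568 (ler0n _ _).
rewrite K0E => /le_trans; apply.
by rewrite ler_wpM2r ?powR_ge0// lerDl ltW.
Qed.
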